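(* Let $s \geq 1$ and let $\emptyset \neq K \subset \mathbb{R}^{2}$ be a compact $s$-Ahlfors-David-regular set. Then there exists a point $x_{0} \in K$ such that $$\dim_{\mathrm{p}} \bigl(K \cdot (K - x_{0})\bigr) = \dim_{\mathrm{p}} \{x_{1} \cdot (x_{2} - x_{0}) : x_{1},x_{2} \in K\} = 1,$$ where $\cdot$ between vectors denotes the Euclidean inner product on $\mathbb{R}^{2}$.
   Context: $K \cdot (K - x_0)$ denotes the set $\{x_{1} \cdot (x_{2} - x_{0}) : x_{1},x_{2} \in K\} \subset \mathbb{R}$. Ahlfors-David regularity. Let $C \geq 1$. A Borel measure $\mu$ on $\mathbb{R}^{d}$ is $(s,C)$-Ahlfors-David regular if $r^{s}/C \leq \mu(B(x,r)) \leq C r^{s}$ for all $x \in \operatorname{spt} \mu$ and $0 < r \leq \operatorname{diam}(\operatorname{spt} \mu)$. An $\mathcal{H}^{s}$-measurable set $K \subset \mathbb{R}^{d}$ is $(s,C)$-Ahlfors-David regular if $0 < \mathcal{H}^{s}(K) < \infty$ and the restriction $\mathcal{H}^{s}|_{K}$ of $s$-dimensional Hausdorff measure to $K$ is an $(s,C)$-Ahlfors-David regular measure. $K$ is $s$-Ahlfors-David regular if it is $(s,C)$-Ahlfors-David regular for some $C \geq 1$. Packing dimension. For bounded $B \subset \mathbb{R}^{d}$, let $N(B,\delta)$ be the least number of $\delta$-balls needed to cover $B$, and let $\overline{\dim}_{\mathrm{B}} B := \limsup_{\delta \to 0} \frac{\log N(B,\delta)}{-\log \delta}$ (upper box dimension).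 The packing dimension is $\dim_{\mathrm{p}} B := \inf\{\sup_{i} \overline{\dim}_{\mathrm{B}} F_{i} : B \subset \bigcup_{i} F_{i}\}$, the infimum being over countable covers of $B$ by bounded closed sets $F_{i}$. *)

(* Defs.v *)
From mathcomp Require Import all_boot all_order all_algebra.
From mathcomp Require Import all_classical all_reals all_analysis.
Set Implicit Arguments.
Unset Strict Implicit.
Unset Printing Implicit Defensive.
Import Order.TTheory GRing.Theory Num.Theory.
Import numFieldNormedType.Exports.
Local Open Scope classical_set_scope.
Local Open Scope ring_scope.

(* R^d is 'rV[R]_d.  Its library norm is the sup norm, so the Euclidean metric
   notions are spelled out here; the topology is the same for both norms. *)
Section Euclidean.
Variables (R : realType) (d : nat).
Implicit Types (x y : 'rV[R]_d) (A : set 'rV[R]_d).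

Definition dotr x y : R := \sum_(i < d) x ord0 i * y ord0 i.

Definition enorm x : R := Num.sqrt (dotr x x).

Definition eball x (r : R) : set 'rV[R]_d := closed_ball_ enorm x r.

(* Equal to 0 on the empty set and to +oo on unbounded sets. *)
Definition ediam A : \bar R :=
  maxe 0%E (ereal_sup [set (enorm (x - y))%:E | x in A & y in A]).

End Euclidean.

Section Hausdorff.
Variables (R : realType) (d : nat).
Implicit Types (s delta : R) (A : set 'rV[R]_d).
Local Open Scope ereal_scope.

(* diam(A)^s; the case distinction matters only for s = 0, where 0^0 = 1 but
   the empty set must have weight 0. *)
Definition diam_pow s A : \bar R :=
  if A == set0 then 0 else ediam A `^ s.

Definition hausdorff_content s delta A : \bar R :=
  ereal_inf [set \sum_(0 <= i <oo) diam_pow s (F i) |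
    F in [set F : nat -> set 'rV[R]_d |
      A `<=` \bigcup_i F i /\ forall i, ediam (F i) <= delta%:E]].

Definition hausdorff_measure s A : \bar R :=
  ereal_sup [set hausdorff_content s delta A |
    delta in [set delta : R | (0 < delta)%R]].

End Hausdorff.

Section AhlforsDavid.
Variables (R : realType) (d : nat).
Implicit Types (s C : R) (mu : set 'rV[R]_d -> \bar R) (K : set 'rV[R]_d).
Local Open Scope ereal_scope.

Definition spt mu : set 'rV[R]_d :=
  [set x | forall U, open_nbhs x U -> 0 < mu U].

(* Stated for any set function; only the values on open sets and on closed
   balls, all of them Borel sets, are involved. *)
Definition AD_regular_measure s C mu : Prop :=
  (1 <= C)%R /\
  forall x (r : R), spt mu x -> (0 < r)%R -> r%:E <= ediam (spt mu) ->
    ((r `^ s)%R / C)%:E <= mu (eball x r) <= (C * (r `^ s)%R)%:E.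

Definition AD_regular_with s C K : Prop :=
  [/\ (hausdorff_measure s).-caratheodory K,
      0 < hausdorff_measure s K < +oo &
      AD_regular_measure s C (fun A => hausdorff_measure s (A `&` K))].

Definition AD_regular s K : Prop := exists C : R, AD_regular_with s C K.

End AhlforsDavid.

Section PackingDimension.
Variables (R : realType) (V : normedModType R).
Implicit Types (B : set V) (delta : R).
Local Open Scope ereal_scope.

(* The infimum is a minimum when B has a finite cover and +oo otherwise. *)
Definition covering_number B delta : \bar R :=
  ereal_inf [set (n%:R : R)%:E |
    n in [set n : nat | exists c : 'I_n -> V,
      B `<=` \bigcup_i closed_ball_ Num.norm (c i) delta]].

(* With lne 0 = -oo the empty set has dimension -oo, so that padding a cover
   with empty sets in packing_dim is harmless. *)
Definition upper_box_dim B : \bar R :=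
  limf_esup (fun delta : R => lne (covering_number B delta) *
                              ((- ln delta)^-1)%:E)
            (0 : R)^'+.

Definition packing_dim B : \bar R :=
  ereal_inf [set ereal_sup (range (fun i => upper_box_dim (F i))) |
    F in [set F : nat -> set V |
      (forall i, bounded_set (F i) /\ closed (F i)) /\
      B `<=` \bigcup_i F i]].

End PackingDimension.

(* Main.v *)
Require Import Defs.
From mathcomp Require Import all_boot all_order all_algebra.
From mathcomp Require Import all_classical all_reals all_analysis.
From mathcomp Require Import measurable_realfun.
From mathcomp Require Import zify ring lra.
Import Order.TTheory GRing.Theory Num.Theory.
Import numFieldNormedType.Exports.
Local Open Scope classical_set_scope.
Local Open Scope ring_scope.
Set Implicit Arguments.
Unset Strict Implicit.
Unset Printing Implicit Defensive.

(** The support S of the restriction of s-dimensional Hausdorff measure to K is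
compact, lies in K, and every ball B(x, r) centred on it contains about D^k
points at mutual distance r / 2^k, where D = 2^s is at least 2.  This counting
property ([counting_regular]) is all that the proof uses of Ahlfors-David
regularity, so it suffices to find x0 in S with the following property: a
countable closed cover of S . (S - x0) by sets F_i cannot have all its members
coverable by at most d^-t balls of radius d, for all small d, with one t < 1.
Upper box dimensions below 1 would provide such a cover, and the bound
dim_p <= 1 is immediate for a bounded subset of the line.  There are two cases.

Case 1: from some x0 in S the directions of the points of S are dense in an
arc.  Fix a scale rho = 2^-(q+1) and choose M = 1 / rho points q_j in S whose
directions from x0 are spread evenly over the arc.  As x . (q_j - x0) is the
orthogonal projection of x in direction q_j - x0, up to a factor, Baire's
theorem applied M times gives a ball B in which each of these M projections
maps S into a single F_i.  Hence all M projections of S in B have at most d^-t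
pieces of size d.  This is impossible.  At one scale, a Marstrand type count
([count_directions], [regular_spread]) shows that on average over the M
directions a ball of S has about rho^-1 / log (1 / rho) distinct projections
at relative scale rho.  A direction that is bad for one ball may be good for
another one, so one cannot follow a single direction down the scales; what can
be iterated is the sum over the M directions of the logarithms of the numbers
of separated projected points ([multiscale]).  The induction works
because, by concavity of the logarithm, each logarithm is bounded below by an
entropy term plus the average over all the sub-balls, the same average for
every direction.  After m steps some projection has at least
(c rho^-1 / log (1 / rho))^m separated points, more than rho^(-t m).

Case 2: from no point of S are the directions dense in an arc.  By Baire's
theorem any prescribed arc contains a smaller arc which is avoided by all
chords of S starting in some ball.  Do this once: in a ball, S is a Lipschitz
graph over a set A of the line, and A has positive length by the counting
property.  Do it again with an arc close to the middle of the remaining cone of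
directions: it splits that cone into two cones, each of angle less than a right
angle.  Near a Lebesgue density point x of A, gaps of A are small
relative to their distance to x, so the slopes of the chords from x vary in
small steps and cannot jump over the avoided arc: all short chords from x to
the right lie in the same cone ([one_sided_at]).  Countably many such pieces
cover almost all of A, so one of them, A', is not negligible
([one_sided_piece]).  For x0, x2 in S over two points of A', the chords over A'
make an angle with x2 - x0 that is bounded away from a right angle, so
x |-> x . (x2 - x0) expands distances on A'.  A countable cover by sets F_i as
above would then make A' negligible. *)

(** * Separated lists and Jensen's inequality *)

Definition separated (R : realType) (V : normedModType R) (d : R) (l : seq V) :=
  pairwise (fun a b => d <= `|a - b|) l.

Section Separated.
Variables (R : realType) (V : normedModType R).
Implicit Types (d : R) (l : seq V).

Lemma separated_flatten (I : eqType) (f : I -> seq V) d (s : seq I) :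
  uniq s -> {in s, forall i, separated d (f i)} ->
  {in s &, forall i j, i != j -> forall a b, a \in f i -> b \in f j ->
    d <= `|a - b|} ->
  separated d (flatten [seq f i | i <- s]).
Proof.
elim: s => [//|i s IH] /= /andP[is_ us] sf sij.
rewrite /separated pairwise_cat; apply/and3P; split.
- apply/allrelP => a b ai /flattenP[l /mapP[j js ->] bj].
  apply: (sij i j) => //; rewrite ?mem_head ?inE ?js ?orbT //.
  by apply: contraNneq is_ => ->.
- by apply: sf; rewrite mem_head.
- apply: IH => // [j js|j k js ks]; first by apply: sf; rewrite inE js orbT.
  by apply: sij; rewrite inE ?js ?ks orbT.
Qed.

End Separated.

Section Jensen.
Variable R : realType.

(** Jensen's inequality for the logarithm, with uniform weights; it follows from
ln y <= y - 1 applied to y = x i / mean. *)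
Lemma sum_ln_le (I : finType) (x : I -> R) : (0 < #|I|)%N ->
  (forall i, 0 < x i) ->
  \sum_i ln (x i) <= #|I|%:R * ln ((\sum_i x i) / #|I|%:R).
Proof.
move=> I0 x0; set N : R := #|I|%:R; have N0 : 0 < N by rewrite ltr0n.
have S0 : 0 < \sum_i x i.
  case/card_gt0P: I0 => i _; rewrite (bigD1 i)//= ltr_pwDl//.
  by apply: sumr_ge0 => j _; exact: ltW.
set A := (\sum_i x i) / N; have A0 : 0 < A by rewrite divr_gt0.
have H i : ln (x i) <= x i / A - 1 + ln A.
  have -> : ln (x i) = ln (x i / A) + ln A.
    by rewrite -lnM ?posrE ?divr_gt0// divfK// gt_eqF.
  rewrite lerD2r; have := @le_ln1Dx R (x i / A - 1).
  rewrite (_ : 1 + _ = x i / A); last by ring.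
  by apply; rewrite ltrBrDl subrr divr_gt0.
apply: (le_trans (ler_sum _ (fun i _ => H i))).
rewrite !big_split/= -mulr_suml !sumr_const.
rewrite -[X in X + _ + _](_ : N = _); last first.
  by rewrite /A; field; rewrite !gt_eqF.
rewrite -[X in _ + X <= _]mulr_natl -[X in _ + X + _]mulr_natl -/N.
by rewrite mulrN mulr1 subrr add0r.
Qed.

End Jensen.

Lemma sum_ord_const (R : realType) (n : nat) (x : R) :
  \sum_(i < n) x = n%:R * x.
Proof. rewrite sumr_const card_ord mulr_natl; reflexivity. Qed.

(** * Projected points in cells of a line *)

Lemma floor_eq_dist (R : realType) (a b l : R) : 0 < l ->
  Num.floor (a / l) = Num.floor (b / l) -> `|a - b| < l.
Proof.
move=> l0 ab.
have /andP[a1 a2] := real_floor_itv (num_real (a / l)).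
have /andP[b1 b2] := real_floor_itv (num_real (b / l)).
rewrite ab in a1 a2.
have -> : a - b = (a / l - b / l) * l by field; rewrite gt_eqF.
rewrite normrM (gtr0_norm l0) -[ltRHS]mul1r ltr_pM2r// ltr_norml.
by rewrite intrD in a2 b2; apply/andP; split; lra.
Qed.

Lemma floor_far_dist (R : realType) (a b l : R) : 0 < l ->
  3 < `|Num.floor (a / l) - Num.floor (b / l)| -> 3 * l < `|a - b|.
Proof.
move=> l0 ab.
have /andP[a1 a2] := real_floor_itv (num_real (a / l)).
have /andP[b1 b2] := real_floor_itv (num_real (b / l)).
have -> : a - b = (a / l - b / l) * l by field; rewrite gt_eqF.
rewrite normrM (gtr0_norm l0) ltr_pM2r//.
rewrite intrD in a2 b2.
set p := Num.floor _ in ab a1 a2; set q := Num.floor _ in ab b1 b2.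
have : (4 : R) <= `|p%:~R - q%:~R|.
  by rewrite -intrB -intr_norm (_ : 4 = 4%:~R)// ler_int; lia.
rewrite ler_normr ltr_normr => /orP[] h; apply/orP; [left|right]; lra.
Qed.

(** The weighted sum gives each cell the average of its members, which is at
most its maximum; so keep one best member per cell.  Keeping only the cells of
one residue class modulo 4, the best one, costs the factor 4 and makes the kept
cells far apart. *)
Lemma select_cells (R : realType) (I : finType) (cell : I -> int) (a : I -> nat) :
  exists T : {set I},
    {in T &, forall i j, i != j -> 3 < `|cell i - cell j|} /\
    \sum_i (a i)%:R / #|[pred k | cell k == cell i]|%:R
      <= 4 * (\sum_(i in T) (a i)%:R : R).
Proof.
pose best i k := (cell k == cell i) &&
  [forall k', (cell k' == cell i) ==> (a k' <= a k)%N].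
have bestP i : exists k, best i k.
  case: (@arg_maxnP _ i (fun k => cell k == cell i) a (eqxx _)) => k ck ak.
  exists k; rewrite /best ck; apply/forallP => k'; apply/implyP => ck'.
  exact: ak.
(* [pick] depends on the predicate only, so that rep is constant on each cell *)
pose rep i := odflt i [pick k | best i k].
have repP i : best i (rep i).
  rewrite /rep; case: pickP => [k //|no]; have [k] := bestP i.
  by rewrite no.
have rep_cell i : cell (rep i) = cell i by have /andP[/eqP] := repP i.
have rep_eq i k : cell i = cell k -> rep i = rep k.
  move=> ik; rewrite /rep.
  have -> : [pick x | best i x] = [pick x | best k x].
    by apply: eq_pick => x; rewrite /best ik.
  by case: pickP => // no; have [x] := bestP k; rewrite no.
pose T0 : {set I} := finset (fun i => rep i == i).
have sumT0 : \sum_i (a i)%:R / #|[pred k | cell k == cell i]|%:R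
      <= \sum_(i in T0) (a i)%:R :> R.
  rewrite (partition_big rep (mem T0))/=; last first.
    by move=> i _; rewrite inE; apply/eqP/rep_eq/rep_cell.
  apply: ler_sum => t; rewrite inE => /eqP rt.
  have eqs : [pred k | cell k == cell t] =i [pred i | rep i == t].
    move=> i; rewrite !inE; apply/idP/idP => /eqP h.
      by rewrite (rep_eq _ _ h) rt.
    by rewrite -h rep_cell.
  have n0 : 0 < #|[pred k | cell k == cell t]|%:R :> R.
    by rewrite ltr0n; apply/card_gt0P; exists t; rewrite inE.
  apply: (@le_trans _ _ (\sum_(i | rep i == t)
      (a t)%:R / #|[pred k | cell k == cell t]|%:R)).
    apply: ler_sum => i /eqP it.
    have <- : cell i = cell t by rewrite -it rep_cell.
    rewrite ler_wpM2r// ler_nat.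
    have /andP[_ /forallP/(_ i)] := repP i.
    by rewrite eqxx /= it.
  rewrite sumr_const -[leLHS]mulr_natr.
  rewrite (_ : #|_| = #|[pred k | cell k == cell t]|); last first.
    by apply: eq_card => i; rewrite eqs.
  by rewrite divfK// gt_eqF.
pose Tc (c : 'I_4) : {set I} :=
  finset (fun i => (i \in T0) && ((`|cell i %% 4|%Z)%N == c :> nat)).
have cl (i : I) : (`|cell i %% 4|%Z < 4)%N by lia.
have splitT : \sum_(i in T0) (a i)%:R = \sum_c \sum_(i in Tc c) (a i)%:R :> R.
  rewrite (partition_big (fun i => Ordinal (cl i)) predT)//=.
  apply: eq_bigr => c _; apply: eq_bigl => i.
  by rewrite !inE; congr (_ && _); apply/eqP/eqP => [<-//|h]; apply: val_inj.
pose w (c : 'I_4) := (\sum_(i in Tc c) a i)%N.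
case: (@arg_maxnP _ ord0 predT w isT) => c _ cmax.
exists (Tc c); split; last first.
  apply: (le_trans sumT0); rewrite splitT.
  apply: (@le_trans _ _ (\sum_(c' < 4) (w c)%:R)).
    by apply: ler_sum => c' _; rewrite -natr_sum ler_nat; exact: cmax.
  by rewrite sumr_const card_ord -natr_sum mulr_natl.
move=> i j; rewrite !inE => /andP[/eqP ri /eqP ci] /andP[/eqP rj /eqP cj] ij.
have : cell i != cell j.
  by apply: contraNneq ij => /rep_eq; rewrite ri rj => ->.
by lia.
Qed.

(** * Induction on scales *)

(** One step of the induction for one projection: p i are the projected centres of
n sub-balls, and L i is a separated list inside the projection of the i-th one.
The union of the lists kept by [select_cells] is separated, and by Jensen its
logarithm exceeds the average of the ln (size (L i)) by ln n minus the average of the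
logarithms of the cell populations.  That difference plays the role of the
entropy of the projected centres.  The average runs over all i, whatever p is;
this is what allows summing over several projections. *)
Lemma branching_step (R : realType) (n : nat) (p : 'I_n -> R) (l d : R)
    (L : 'I_n -> seq R) :
  0 < l -> d <= l -> (0 < n)%N ->
  (forall i, (0 < size (L i))%N /\ separated d (L i)) ->
  (forall i z, z \in L i -> `|z - p i| <= l) ->
  exists T : {set 'I_n}, let L' := flatten [seq L i | i <- enum T] in
    [/\ (0 < size L')%N, separated d L' &
     \sum_i (ln (size (L i))%:R + ln n%:R
        - ln (\sum_k (`|p i - p k| < l)%R%:R))
       <= n%:R * (ln (size L')%:R + ln 4) :> R].
Proof.
move=> l0 dl n0 Lsep Lp.
pose cell i := Num.floor (p i / l).
have [T [Tfar Tsum]] := select_cells R cell (fun i => size (L i)).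
exists T => L'.
have sL' : (size L')%:R = \sum_(i in T) (size (L i))%:R :> R.
  rewrite size_flatten /shape -map_comp sumnE big_map -natr_sum big_enum //.
have cardn i : #|[pred k | cell k == cell i]|%:R
    <= \sum_k (`|p i - p k| < l)%R%:R :> R.
  rewrite -sum1_card natr_sum big_mkcond/=; apply: ler_sum => k _.
  rewrite inE; case: eqP => [ck|_]; last by case: (_ < _).
  by rewrite (floor_eq_dist l0 (esym ck)).
have card0 i : 0 < #|[pred k | cell k == cell i]|%:R :> R.
  by rewrite ltr0n; apply/card_gt0P; exists i; rewrite inE.
have sum0 : 0 < \sum_i (size (L i))%:R / #|[pred k | cell k == cell i]|%:R :> R.
  rewrite (bigD1 (Ordinal n0))//= ltr_pwDl//.
    by rewrite divr_gt0// ltr0n; have [] := Lsep (Ordinal n0).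
  by apply: sumr_ge0 => i _; rewrite divr_ge0// ltW.
have L'0 : (0 < size L')%N.
  rewrite -(ltr0n R) sL'; rewrite -(@pmulr_rgt0 _ 4)//.
  exact: lt_le_trans sum0 Tsum.
split => //.
  apply: separated_flatten; first exact: enum_uniq.
    by move=> i _; have [] := Lsep i.
  move=> i k; rewrite !mem_enum => iT kT ik a b /Lp ai /Lp bk.
  have := floor_far_dist l0 (Tfar _ _ iT kT ik).
  move: ai bk; rewrite !ler_norml => /andP[a1 a2] /andP[b1 b2].
  rewrite lter_normr => /orP[] h; rewrite ler_normr; apply/orP; [left|right]; lra.
pose x i : R := n%:R * ((size (L i))%:R / #|[pred k | cell k == cell i]|%:R).
have nR : 0 < n%:R :> R by rewrite ltr0n.
have x0 i : 0 < x i.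
  by rewrite mulr_gt0// divr_gt0// ltr0n; have [] := Lsep i.
apply: (@le_trans _ _ (\sum_i ln (x i))).
  apply: ler_sum => i _; have Li : 0 < (size (L i))%:R :> R.
    by rewrite ltr0n; have [] := Lsep i.
  rewrite /x lnM ?posrE ?divr_gt0// ln_div ?posrE//.
  rewrite addrA [X in _ <= X - _]addrC lerD2l lerN2 ler_ln ?posrE//.
  exact: lt_le_trans (card0 i) (cardn i).
apply: (le_trans (sum_ln_le _ x0)); first by rewrite card_ord.
rewrite card_ord ler_wpM2l ?ler0n// -lnM ?posrE ?ltr0n//.
have xs : (\sum_i x i) / n%:R =
    \sum_i (size (L i))%:R / #|[pred k | cell k == cell i]|%:R.
  by rewrite -mulr_sumr mulrC mulKf// gt_eqF.
rewrite xs ler_ln ?posrE ?mulr_gt0 ?ltr0n//.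
by rewrite mulrC sL'.
Qed.

Section Multiscale.
Variables (R : realType) (V : normedModType R) (S : set V).
Variables (M : nat) (proj : 'I_M -> V -> R) (c rho gain R1 : R).
Hypothesis M_gt0 : (0 < M)%N.
Hypothesis c_gt0 : 0 < c.
Hypothesis rho_gt0 : 0 < rho.
Hypothesis rho_le : rho <= 2^-1.
Hypothesis gain_gt0 : 0 < gain.
Hypothesis proj_lip : forall j u v, `|proj j u - proj j v| <= c * `|u - v|.
(** The single-scale input: each ball of S contains n points for which, on average
over i and j, at most n / gain of the projected points lie near proj j (y i). *)
Hypothesis spread : forall x r, S x -> 0 < r -> r <= R1 ->
  exists n (y : 'I_n -> V), [/\ (0 < n)%N,
    forall i, S (y i) /\ `|y i - x| <= r / 2 &
    gain * (\sum_(i < n) \sum_(k < n) \sum_(j < M)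
       (`|proj j (y i) - proj j (y k)| < c * rho * r)%R%:R)
      <= M%:R * n%:R ^+ 2].

(** The logarithms of the sizes are summed over j before the induction is used: the
lists given by the induction for the n sub-balls satisfy a bound on that sum
only, and [branching_step] averages over the sub-balls with weights that are the
same for each j. *)
Lemma multiscale m x r : S x -> 0 < r -> r <= R1 ->
  exists L : 'I_M -> seq R,
    (forall j, [/\ (0 < size (L j))%N, separated (c * rho ^+ m * r) (L j) &
       forall z, z \in L j -> exists y, [/\ S y, `|y - x| <= r & z = proj j y]]) /\
    m%:R * (M%:R * (ln gain - ln 4)) <= \sum_j ln (size (L j))%:R.
Proof.
elim: m x r => [|m IH] x r Sx r0 rR.
  exists (fun j => [:: proj j x]); split.
    move=> j; split => // z; rewrite inE => /eqP->.
    by exists x; rewrite subrr normr0 ltW.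
  by rewrite mul0r big1// => j _; rewrite ln1.
have [n [y [n0 Sy ngain]]] := spread Sx r0 rR.
have rho1 : rho <= 1 by apply: le_trans rho_le _; rewrite invf_le1// ler1n.
have rr0 : 0 < rho * r by rewrite mulr_gt0.
have rrR : rho * r <= R1.
  by apply: le_trans rR; rewrite ger_pMl.
have H i : exists L : 'I_M -> seq R,
    (forall j, [/\ (0 < size (L j))%N, separated (c * rho ^+ m * (rho * r)) (L j) &
       forall z, z \in L j -> exists y', [/\ S y', `|y' - y i| <= rho * r & z = proj j y']]) /\
    m%:R * (M%:R * (ln gain - ln 4)) <= \sum_j ln (size (L j))%:R.
  by apply: IH => //; have [] := Sy i.
have {H} [L LP] := choice H.
have rhom : rho ^+ m <= 1.
  by apply: exprn_ile1 => //; exact: ltW.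
have HT j : exists T : {set 'I_n}, let L' := flatten [seq L i j | i <- enum T] in
    [/\ (0 < size L')%N, separated (c * rho ^+ m * (rho * r)) L' &
     \sum_i (ln (size (L i j))%:R + ln n%:R
        - ln (\sum_k (`|proj j (y i) - proj j (y k)| < c * rho * r)%R%:R))
       <= n%:R * (ln (size L')%:R + ln 4) :> R].
  apply: (@branching_step _ _ (fun i => proj j (y i)) (c * rho * r)
    (c * rho ^+ m * (rho * r)) (fun i => L i j)) => //.
  - by rewrite !mulr_gt0.
  - rewrite -!mulrA ler_pM2l// ger_pMl//.
  - by move=> i; have [/(_ j)[]] := LP i.
  - move=> i z zL; have [/(_ j)[_ _ /(_ z zL)[y' [_ yy ->]]] _] := LP i.
    by rewrite (le_trans (proj_lip _ _ _))// -mulrA ler_pM2l.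
have {HT} [T TP] := choice HT.
exists (fun j => flatten [seq L i j | i <- enum (T j)]); split.
  move=> j; have [s0 ss _] := TP j; split => //.
    by rewrite exprSr !mulrA in ss *.
  move=> z /flattenP[l /mapP[i _ ->]] zl.
  have [/(_ j)[_ _ /(_ z zl)[y' [Sy' yy ->]]] _] := LP i.
  exists y'; split => //.
  rewrite -(subrKA (y i)) (le_trans (ler_normD _ _))//.
  have [_ yx] := Sy i; have : rho * r <= r / 2 by rewrite mulrC ler_pM2l.
  lra.
set t : R := ln gain - ln 4.
have nR : 0 < n%:R :> R by rewrite ltr0n.
have MR : 0 < M%:R :> R by rewrite ltr0n.
rewrite -(ler_pM2l nR).
pose N i j : R := \sum_k (`|proj j (y i) - proj j (y k)| < c * rho * r)%R%:R.
have N0 i j : 0 < N i j.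
  rewrite /N (bigD1 i)//= subrr normr0 !mulr_gt0// ltr_pwDl//.
  by apply: sumr_ge0 => k _; case: (_ < _).
have lnN : \sum_i \sum_j ln (N i j) <= n%:R * M%:R * (ln n%:R - ln gain).
  rewrite pair_bigA/=.
  have n0M : (0 < #|{: 'I_n * 'I_M}|)%N by rewrite card_prod !card_ord muln_gt0 n0.
  apply: (le_trans (sum_ln_le n0M _)); first by move=> [i j]; exact: N0.
  rewrite card_prod !card_ord natrM ler_pM2l ?mulr_gt0//.
  have sN : gain * (\sum_p N p.1 p.2) <= M%:R * n%:R ^+ 2.
    apply: le_trans ngain; rewrite ler_pM2l// -(pair_bigA _ N)/=.
    apply: ler_sum => i _; rewrite exchange_big/=.
    by apply: ler_sum => k _.
  have sN0 : 0 < \sum_p N p.1 p.2.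
    rewrite (bigD1 (Ordinal n0, Ordinal M_gt0))//= ltr_pwDl//.
    by apply: sumr_ge0 => p _; exact: ltW.
  rewrite -ln_div ?posrE// ler_ln ?posrE ?divr_gt0 ?mulr_gt0//.
  rewrite ler_pdivrMr ?mulr_gt0// mulrAC ler_pdivlMr// mulrC.
  by rewrite (le_trans sN)// expr2 mulrC mulrA.
have S1 : \sum_j \sum_i (ln (size (L i j))%:R + ln n%:R - ln (N i j)) <=
    \sum_j n%:R * (ln (size (flatten [seq L i j | i <- enum (T j)]))%:R + ln 4).
  by apply: ler_sum => j _; have [] := TP j.
have S1E : \sum_j \sum_i (ln (size (L i j))%:R + ln n%:R - ln (N i j)) =
    \sum_i \sum_j ln (size (L i j))%:R + n%:R * (M%:R * ln n%:R)
    - \sum_i \sum_j ln (N i j).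
  rewrite exchange_big/= (eq_bigr (fun i => \sum_j ln (size (L i j))%:R
    + M%:R * ln n%:R - \sum_j ln (N i j))); last first.
    move=> i _; rewrite sumrB big_split/=; congr (_ + _ - _).
    exact: sum_ord_const.
  rewrite sumrB big_split/=; congr (_ + _ - _).
  exact: sum_ord_const.
rewrite S1E -mulr_sumr big_split/= [X in _ <= _ * (_ + X)]sum_ord_const in S1.
have S2 : n%:R * (m%:R * (M%:R * t)) <= \sum_i \sum_j ln (size (L i j))%:R.
  rewrite -sum_ord_const.
  by apply: ler_sum => i _; have [] := LP i.
rewrite -natr1 mulrDl mulrDr mul1r; rewrite /t in S2 *.
set a := \sum_i \sum_j _ in S1 S2; set e := \sum_i _ in lnN S1.
set b := \sum_j _.
rewrite -/b in S1.
move: S1 S2 lnN; lra.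
Qed.

End Multiscale.

(** * Average size of a projection at one scale *)

(** Ahlfors-David regularity at dyadic scales, with D = 2^s, stated by counting
separated points instead of measuring balls. *)
Definition counting_regular (R : realType) (V : normedModType R) (S : set V)
    (D C R0 : R) : Prop :=
  [/\ 2 <= D, 1 <= C, 0 < R0 &
   forall x r k, S x -> 0 < r -> r <= R0 ->
    (forall l : seq V, (forall y, y \in l -> S y /\ `|y - x| <= r) ->
       separated (r / 2 ^+ k) l -> (size l)%:R <= C * D ^+ k) /\
    (exists l : seq V, [/\ forall y, y \in l -> S y /\ `|y - x| <= r,
       separated (r / 2 ^+ k) l & D ^+ k <= C * (size l)%:R])].

Lemma dyadic_bracket (R : realType) q (t : R) : 1 <= t -> t <= 2 ^+ q ->
  exists k, [/\ (k <= q)%N, 2 ^+ k <= t & t <= 2 ^+ k.+1].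
Proof.
elim: q => [|q IH] t1 tq.
  by exists 0%N; split; rewrite ?expr0// expr1; rewrite expr0 in tq; lra.
have [/(IH t1)[k [kq kt tk]]|qt] := leP t (2 ^+ q).
  by exists k; split => //; exact: leqW.
by exists q; split => //; exact: ltW.
Qed.

Section Spread.
Variables (R : realType) (V : normedModType R) (S : set V) (D C R0 : R).
Hypothesis regS : counting_regular S D C R0.
Variables (q : nat) (proj : 'I_(2 ^ q.+1) -> V -> R) (c C2 : R).
Let rho : R := (2 ^+ q.+1)^-1.
Hypothesis C2_ge0 : 0 <= C2.
Hypothesis transversal : forall u v r, 0 < r -> rho * r <= `|u - v| ->
  `|u - v| <= r ->
  \sum_j (`|proj j u - proj j v| < c * rho * r)%R%:R <= C2 * (r / `|u - v|).

(** Count the triples (i, k, j) for which y i and y k have close projections.  At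
distance |y i - y k| = 2^m rho r there are at most D^(m + 1) points y k, up to
a constant, and C2 2^(q + 1 - m) directions j.  As D >= 2, each dyadic range of m
contributes at most D^(q + 2); there are q + 2 ranges. *)
Lemma regular_spread x r : S x -> 0 < r -> r <= R0 / 4 ->
  exists n (y : 'I_n -> V), [/\ (0 < n)%N,
    forall i, S (y i) /\ `|y i - x| <= r / 2 &
    (2 ^+ q.+1 / ((1 + C2 * C) * C * D ^+ 2 * q.+2%:R)) *
     (\sum_(i < n) \sum_(k < n) \sum_(j < 2 ^ q.+1)
       (`|proj j (y i) - proj j (y k)| < c * rho * r)%R%:R)
      <= (2 ^ q.+1)%N%:R * n%:R ^+ 2].
Proof.
move=> Sx r0 rR; have [D2 C1 R00 reg] := regS.
have D0 : 0 < D by lra.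
have C0 : 0 < C by lra.
have [_ [l [lS lsep lsize]]] := reg x (r / 2) q Sx ltac:(lra) ltac:(lra).
have rhoE : r / 2 / 2 ^+ q = rho * r.
  by rewrite /rho exprS; field; rewrite expf_neq0.
rewrite rhoE in lsep.
have rho0 : 0 < rho by rewrite invr_gt0 exprn_gt0.
have rr0 : 0 < rho * r by rewrite mulr_gt0.
have l0 : (0 < size l)%N.
  rewrite lt0n; apply: contraTneq lsize => ->.
  by rewrite mulr0 -ltNge exprn_gt0.
pose y i := tnth (in_tuple l) i.
have yl i : y i \in l by exact: mem_tnth.
have ysep (i k : 'I_(size l)) : i != k -> rho * r <= `|y i - y k|.
  rewrite /y !(tnth_nth 0)/= => ik.
  have /(pairwiseP 0) P := lsep.
  have [lt|lt|/val_inj e] := ltngtP i k; last by rewrite e eqxx in ik.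
    by apply: P; rewrite ?inE.
  by rewrite distrC; apply: P; rewrite ?inE.
have yr i k : `|y i - y k| <= r.
  have [_ h1] := lS _ (yl i); have [_ h2] := lS _ (yl k).
  rewrite -(subrKA x) (le_trans (ler_normD _ _))// [X in _ + X]distrC.
  lra.
exists (size l), y; split => //.
  by move=> i; exact: lS.
have shell (i : 'I_(size l)) k : (k <= q.+1)%N ->
    \sum_i' (`|y i - y i'| <= 2 ^+ k.+1 * (rho * r))%R%:R <= C * D ^+ k.+1 :> R.
  move=> kq; pose l' := [seq z <- l | `|y i - z| <= 2 ^+ k.+1 * (rho * r)].
  have -> : \sum_i' (`|y i - y i'| <= 2 ^+ k.+1 * (rho * r))%R%:R = (size l')%:R :> R.
    rewrite size_filter -sum1_count natr_sum (big_tnth _ _ l) [RHS]big_mkcond/=.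
    by apply: eq_bigr => i' _; case: (_ <= _).
  have [S1 _] := lS _ (yl i).
  have pk : 0 < 2 ^+ k.+1 :> R by rewrite exprn_gt0.
  have r'0 : 0 < 2 ^+ k.+1 * (rho * r) by rewrite mulr_gt0.
  have r'R : 2 ^+ k.+1 * (rho * r) <= R0.
    apply: (@le_trans _ _ (2 * r)); last lra.
    rewrite mulrA ler_pM2r// /rho ler_pdivrMr ?exprn_gt0//.
    by rewrite -exprS; apply: ler_weXn2l; rewrite ?ler1n // ltnS.
  have [up _] := reg (y i) (2 ^+ k.+1 * (rho * r)) k.+1 S1 r'0 r'R.
  apply: up => [z|].
    by rewrite mem_filter => /andP[zy /lS[Sz _]]; rewrite distrC.
  rewrite mulrC mulKf ?gt_eqF//.
  exact: pairwise_filter.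
have powD k : (k <= q.+1)%N -> 2 ^+ (q.+1 - k) * D ^+ k.+1 <= D ^+ q.+2.
  move=> kq; rewrite -[q.+2](subnK (_ : (k.+1 <= q.+2)%N))// exprD subSS.
  rewrite ler_pM2r ?exprn_gt0//; apply: lerXn2r; rewrite ?nnegrE//; lra.
have row (i : 'I_(size l)) : \sum_k \sum_j (`|proj j (y i) - proj j (y k)| < c * rho * r)%R%:R
    <= (1 + C2 * C) * D ^+ q.+2 * q.+2%:R.
  rewrite (bigD1 i)//=.
  have h1 : \sum_j (`|proj j (y i) - proj j (y i)| < c * rho * r)%R%:R <= D ^+ q.+2.
    apply: (@le_trans _ _ (\sum_(j < 2 ^ q.+1) 1)).
      by apply: ler_sum => j _; case: (_ < _).
    rewrite sum_ord_const mulr1 natrX (le_trans _ (powD 0 isT))// subn0 expr1.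
    by rewrite ler_peMr ?exprn_ge0//; lra.
  have h2 : \sum_(k < size l | k != i) \sum_j (`|proj j (y i) - proj j (y k)| < c * rho * r)%R%:R
     <= \sum_(k < size l) C2 * \sum_(m < q.+2)
          2 ^+ (q.+1 - m) * (`|y i - y k| <= 2 ^+ m.+1 * (rho * r))%R%:R.
    rewrite big_mkcond/=; apply: ler_sum => k _.
    case: ifPn => [ki|_]; last first.
      apply: mulr_ge0 => //; apply: sumr_ge0 => m _.
      by rewrite mulr_ge0 ?exprn_ge0 ?ler0n.
    have s1 := ysep i k; rewrite eq_sym ki in s1; have {}s1 := s1 isT.
    apply: (le_trans (transversal r0 s1 (yr i k))).
    rewrite ler_wpM2l//.
    have [m [mq m1 m2]] : exists m, [/\ (m <= q.+1)%N,
        2 ^+ m <= `|y i - y k| / (rho * r) &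
        `|y i - y k| / (rho * r) <= 2 ^+ m.+1].
      apply: dyadic_bracket; first by rewrite ler_pdivlMr// mul1r.
      rewrite ler_pdivrMr// /rho mulrA divff ?mul1r ?expf_neq0//.
    have mq' : (m < q.+2)%N by [].
    rewrite (bigD1 (Ordinal mq'))//= ler_wpDr//.
      apply: sumr_ge0 => m' _; by rewrite mulr_ge0 ?exprn_ge0 ?ler0n.
    rewrite ler_pdivrMr// in m2; rewrite m2 mulr1.
    have u0 : 0 < `|y i - y k| by exact: lt_le_trans s1.
    rewrite ler_pdivrMr// expfB_cond; last by rewrite pnatr_eq0.
    rewrite ler_pdivlMr// in m1; rewrite mulrAC ler_pdivlMr ?exprn_gt0//.
    move: m1; rewrite /rho => m1.
    have := ler_wpM2l (ltW (exprn_gt0 q.+1 (ltr0n R 2))) m1.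
    rewrite [2 ^+ q.+1 * (2 ^+ m * _)]mulrCA [2 ^+ q.+1 * (_ * r)]mulrA divff ?expf_neq0//.
    by rewrite mul1r mulrC.
  apply: (le_trans (lerD h1 h2)).
  rewrite -mulr_sumr exchange_big/=.
  have h3 : \sum_(m < q.+2) \sum_(k < size l)
       2 ^+ (q.+1 - m) * (`|y i - y k| <= 2 ^+ m.+1 * (rho * r))%R%:R
     <= \sum_(m < q.+2) C * D ^+ q.+2.
    apply: ler_sum => m _; rewrite -mulr_sumr.
    have mq : (m <= q.+1)%N by rewrite -ltnS.
    apply: (@le_trans _ _ (2 ^+ (q.+1 - m) * (C * D ^+ m.+1))).
      by rewrite ler_wpM2l ?exprn_ge0// shell.
    by rewrite mulrCA ler_pM2l// powD.
  rewrite sum_ord_const in h3.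
  have := ler_wpM2l C2_ge0 h3.
  have : D ^+ q.+2 <= D ^+ q.+2 * q.+2%:R by rewrite ler_peMr ?exprn_ge0 ?ler1n// ltW.
  set X := D ^+ q.+2; set Q := q.+2%:R; lra.
have tot : \sum_(i < size l) \sum_k \sum_j (`|proj j (y i) - proj j (y k)| < c * rho * r)%R%:R
    <= (size l)%:R * ((1 + C2 * C) * D ^+ q.+2 * q.+2%:R).
  by rewrite -sum_ord_const; apply: ler_sum => i _; exact: row.
have C20 : 0 <= C2 * C by rewrite mulr_ge0// ltW.
have den0 : 0 < (1 + C2 * C) * C * D ^+ 2 * q.+2%:R.
  by rewrite !mulr_gt0 ?exprn_gt0//; lra.
rewrite mulrAC ler_pdivrMr// natrX -[leRHS]mulrA ler_pM2l ?exprn_gt0//.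
apply: (le_trans tot).
rewrite expr2 -[leRHS]mulrA ler_pM2l ?ltr0n//.
rewrite -addn2 exprD.
have : 0 <= (1 + C2 * C) * D ^+ 2 * q.+2%:R.
  by rewrite !mulr_ge0 ?exprn_ge0//; lra.
move=> /ler_wpM2l /(_ _ _ lsize).
set X := D ^+ q; set Q := q.+2%:R; set Y := D ^+ 2; lra.
Qed.

End Spread.

Lemma count_close_ord (R : realType) (M : nat) (P : pred 'I_M) (X : R) :
  0 <= X -> (forall i j, P i -> P j -> `|i%:R - j%:R| <= X) ->
  \sum_j (P j)%:R <= 1 + X.
Proof.
move=> X0 PX; have [i0 Pi0|P0] := pickP P; last first.
  by rewrite big1 ?addr_ge0// => j _; rewrite P0.
case: (@arg_minnP _ i0 P (fun i => i : nat) Pi0) => i Pi imin.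
case: (@arg_maxnP _ i0 P (fun i => i : nat) Pi0) => k Pk kmax.
have ik : (i <= k)%N by exact: imin.
apply: (@le_trans _ _ (1 + (k - i)%N%:R)); last first.
  rewrite lerD2l natrB//; have := PX _ _ Pk Pi.
  by apply: le_trans; exact: ler_norm.
rewrite -natr_sum -(natrD _ 1) ler_nat add1n.
rewrite (_ : (\sum_j P j)%N = #|P|); last first.
  by rewrite -sum1_card [RHS]big_mkcond; apply: eq_bigr => j _; rewrite unfold_in; case: (P j).
rewrite cardE -(size_map val) -[X in (_ <= X)%N](size_iota i).
apply: uniq_leq_size; first by rewrite (map_inj_uniq val_inj) enum_uniq.
move=> z /mapP[j]; rewrite mem_enum => Pj ->.
rewrite mem_iota/=; have h1 := imin j Pj; have h2 := kmax j Pj; simpl in h1, h2; lia.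
Qed.

(** The condition |al + sigma j * be| < small confines sigma j to an interval of
length small / |be|; when be is so small that this says nothing, al dominates
and the condition cannot hold unless t is comparable with the resolution, in
which case all M directions may be counted. *)
Lemma count_directions (R : realType) (M : nat) (sigma : 'I_M -> R)
    (A Sig e c r t al be : R) : (0 < M)%N ->
  0 < A -> 0 <= Sig -> 0 < e -> 0 < c ->
  (forall j, `|sigma j| <= Sig) ->
  (forall i j : 'I_M, e * `|i%:R - j%:R| / M%:R <= `|sigma i - sigma j|) ->
  0 < t -> t <= r -> t <= A * `|al| \/ t <= A * `|be| ->
  \sum_j (`|al + sigma j * be| < c * M%:R^-1 * r)%R%:R
    <= (1 + 2 * c * (A * (1 + 2 * Sig)) / e + 2 * A * c) * (r / t).
Proof.
move=> M0 A0 Sig0 e0 c0 sigS sige t0 tr tab.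
have MR : 0 < M%:R :> R by rewrite ltr0n.
have rt1 : 1 <= r / t by rewrite ler_pdivlMr// mul1r.
set B := A * (1 + 2 * Sig); have B0 : 0 < B by rewrite mulr_gt0//; lra.
have cB0 : 0 <= 2 * c * B / e by rewrite !mulr_ge0 ?invr_ge0//; lra.
have Ac0 : 0 <= 2 * A * c by rewrite !mulr_ge0; lra.
have [tB|Bt] := leP t (B * `|be|).
  apply: (@le_trans _ _ (1 + 2 * c * B / e * (r / t))); last first.
    have : 0 <= 2 * A * c * (r / t) by rewrite mulr_ge0//; lra.
    lra.
  apply: count_close_ord => [|i j Hi Hj]; first by rewrite mulr_ge0//; lra.
  have h : `|sigma i - sigma j| * `|be| <= 2 * c * M%:R^-1 * r.
    rewrite -normrM (_ : _ * be = (al + sigma i * be) - (al + sigma j * be)); last by ring.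
    by rewrite (le_trans (ler_normB _ _))//; lra.
  have h2 : e * `|i%:R - j%:R| / M%:R * t <= B * (2 * c * M%:R^-1 * r).
    apply: (@le_trans _ _ (`|sigma i - sigma j| * (B * `|be|))).
      by apply: ler_pM => //; rewrite ?divr_ge0 ?mulr_ge0// ltW.
    by rewrite mulrCA ler_pM2l.
  rewrite mulrA ler_pdivlMr// mulrAC ler_pdivlMr//.
  rewrite -(@ler_pM2r _ M%:R^-1) ?invr_gt0//.
  move: h2; set x := `|_|; set mi := M%:R^-1; lra.
have sb j : 2 * A * `|sigma j * be| < t.
  apply: le_lt_trans Bt; rewrite normrM /B.
  have : `|sigma j| * `|be| <= Sig * `|be| by rewrite ler_wpM2r.
  have : 0 <= A * `|be| by rewrite mulr_ge0// ltW.
  move=> h1 /(ler_wpM2l (ltW A0)); lra.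
have ta : t <= A * `|al|.
  case: tab => // tb; suff : A * `|be| <= B * `|be| by lra.
  rewrite ler_wpM2r// /B; have : 0 <= A * Sig by rewrite mulr_ge0// ltW.
  lra.
have [j0 Hj0|H0] := pickP (fun j => `|al + sigma j * be| < c * M%:R^-1 * r); last first.
  rewrite big1; last by move=> j _; rewrite H0.
  by rewrite mulr_ge0//; lra.
apply: (@le_trans _ _ M%:R).
  apply: (@le_trans _ _ (\sum_(j < M) 1)).
    by apply: ler_sum => j _; case: (_ < _).
  by rewrite sum_ord_const mulr1.
apply: (@le_trans _ _ (2 * A * c * (r / t))); last first.
  by rewrite ler_wpM2r//; lra.
have : `|al| <= `|al + sigma j0 * be| + `|sigma j0 * be|.
  by rewrite -{1}(addrK (sigma j0 * be) al) ler_normB.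
move=> /(ler_wpM2l (ltW A0)) h.
have := sb j0; have := ler_wpM2l (ltW A0) (ltW Hj0) => h1 h2.
have h3 : t <= 2 * A * c * r * M%:R^-1 by lra.
by rewrite mulrA ler_pdivlMr// mulrC -ler_pdivlMr.
Qed.

(** * Thin projections in evenly spread directions are impossible *)

(** The form in which upper box dimension less than t is used: see [box_dim_thin]. *)
Definition box_thin (R : realType) (t : R) (F : set R) : Prop :=
  exists2 d0 : R, 0 < d0 & forall d, 0 < d -> d < d0 ->
    exists n (c : 'I_n -> R),
      F `<=` \bigcup_i closed_ball_ Num.norm (c i) d /\
      ln n%:R <= t * (- ln d).

Lemma separated_cover_size (R : realType) (d e : R) (l : seq R) n (c : 'I_n -> R) :
  0 < d -> 2 * d < e -> separated e l ->
  (forall z, z \in l -> exists i, `|c i - z| <= d) ->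
  (size l <= n)%N.
Proof.
move=> d0 de lsep lc.
have ul : uniq l.
  rewrite uniq_pairwise; apply: sub_pairwise lsep => a b /=; apply: contraTneq => ->.
  by rewrite subrr normr0 -ltNge; lra.
have [->|l0] := eqVneq l [::]; first by [].
have [z0 z0l] : exists z, z \in l by case: (l) l0 => // z ? _; exists z; rewrite mem_head.
have H z : exists i, z \in l -> `|c i - z| <= d.
  have [/lc[i ci]|zl] := boolP (z \in l); first by exists i.
  by have [i _] := lc _ z0l; exists i.
have [f fP] := choice H.
rewrite -(card_ord n) -(size_map f) cardE; apply: uniq_leq_size.
  rewrite map_inj_in_uniq// => a b al bl fab; apply/eqP; apply: contraTT lsep => ab.
  apply/negP => /(pairwiseP 0) P.
  have ia : (index a l < size l)%N by rewrite index_mem.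
  have ib : (index b l < size l)%N by rewrite index_mem.
  have : `|a - b| <= 2 * d.
    rewrite (_ : a - b = (c (f b) - b) - (c (f a) - a)); last by rewrite fab; ring.
    rewrite (le_trans (ler_normB _ _))// mulrDl mul1r lerD//; exact: fP.
  apply/negP; rewrite -ltNge; apply: lt_le_trans de _.
  have [lt|lt|eqi] := ltngtP (index a l) (index b l).
  - by have := P _ _ ia ib lt; rewrite !nth_index.
  - by have := P _ _ ib ia lt; rewrite !nth_index// distrC.
  - by move: ab; rewrite -(nth_index 0 al) eqi nth_index// eqxx.
by move=> i _; rewrite mem_enum.
Qed.

(** A logarithm is eventually below any linear function; this absorbs the constants
and the factor log (1 / rho) lost at each scale. *)
Lemma log_absorbed (R : realType) (eta K : R) : 0 < eta -> 0 < K ->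
  exists q : nat, ln (K * q.+2%:R) < eta * q.+1%:R.
Proof.
move=> e0 K0.
have H y : 0 < y -> ln y <= eta / 2 * y + ln (2 / eta).
  move=> y0; have -> : ln y = ln (eta / 2 * y) + ln (2 / eta).
    by rewrite -lnM ?posrE ?divr_gt0 ?mulr_gt0//; congr ln; field; rewrite gt_eqF.
  rewrite lerD2r; have := @le_ln1Dx R (eta / 2 * y - 1).
  have z0 : 0 < eta / 2 * y by rewrite !mulr_gt0.
  rewrite (_ : 1 + _ = eta / 2 * y); last by ring.
  by move=> /(_ ltac:(lra)); lra.
set B := ln K + eta / 2 + ln (2 / eta).
pose q := Num.truncn (`|B| / (eta / 2)); exists q.
have e2 : 0 < eta / 2 by lra.
have := truncnS_gt (`|B| / (eta / 2)); rewrite -/q ltr_pdivrMr// => qB.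
rewrite lnM ?posrE//; have := H q.+2%:R (ltr0Sn _ _).
rewrite -[q.+2]addn1 natrD; have := ler_norm B; rewrite {1}/B => h1 h2.
move: h1 h2 qB; set x : R := q.+1%:R; lra.
Qed.

Lemma geometric_small (R : realType) (k : nat) (X x : R) : 0 < x ->
  exists N, forall m, (N <= m)%N -> X * (2 ^+ k.+1)^-1 ^+ m < x.
Proof.
move=> x0; pose N := (Num.truncn (`|X| / x)).+1; exists N => m Nm.
rewrite -exprVn -exprM exprVn ltr_pdivrMr ?exprn_gt0//.
have := truncnS_gt (`|X| / x); rewrite -/N ltr_pdivrMr// => h.
apply: (le_lt_trans (ler_norm X)); apply: (lt_le_trans h).
rewrite mulrC ler_pM2l// -natrX ler_nat.
apply: (leq_trans Nm); apply: (leq_trans (ltnW (ltn_expl m (ltnSn 1)))).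
by rewrite leq_exp2l// leq_pmull.
Qed.

Section ThinProjections.
Variables (R : realType) (V : normedModType R) (S : set V) (D C R0 : R).
Hypothesis regS : counting_regular S D C R0.
Variables (a b : V -> R) (A al be t : R).
Hypothesis aB : forall u v, a (u - v) = a u - a v.
Hypothesis bB : forall u v, b (u - v) = b u - b v.
Hypothesis A_gt0 : 0 < A.
Hypothesis a_le : forall u, `|a u| <= A * `|u|.
Hypothesis b_le : forall u, `|b u| <= A * `|u|.
Hypothesis ab_ge : forall u, `|u| <= A * `|a u| \/ `|u| <= A * `|b u|.
Hypothesis albe : al < be.
Hypothesis t_lt1 : t < 1.

(** The scale 2^-(q + 1) is fixed first; the directions sigma, the factors lam and
the sets F may depend on it, as the points giving these directions will be chosen
afterwards. *)
Lemma no_thin_projections : exists q, forall sigma : 'I_(2 ^ q.+1) -> R,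
  (forall j, al <= sigma j <= be) ->
  (forall i j : 'I_(2 ^ q.+1),
     (be - al) / 2 * `|i%:R - j%:R| / (2 ^ q.+1)%N%:R <= `|sigma i - sigma j|) ->
  forall (lam : 'I_(2 ^ q.+1) -> R) (F : 'I_(2 ^ q.+1) -> set R),
  (forall j, lam j != 0) -> (forall j, box_thin t (F j)) ->
  forall x (r : R), S x -> 0 < r ->
  ~ (forall y j, S y -> `|y - x| <= r -> F j (lam j * (a y + sigma j * b y))).
Proof.
have [D2 C1 R00 _] := regS.
set Sig : R := `|al| + `|be|; have Sig0 : 0 <= Sig by rewrite addr_ge0.
set c := A * (1 + Sig); have c0 : 0 < c by rewrite mulr_gt0// ltr_wpDr.
set e := (be - al) / 2; have e0 : 0 < e by rewrite divr_gt0 ?subr_gt0.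
set C2 := 1 + 2 * c * (A * (1 + 2 * Sig)) / e + 2 * A * c.
have C20 : 0 <= C2.
  have h1 : 0 <= 2 * c * (A * (1 + 2 * Sig)) / e.
    apply: divr_ge0; last exact: ltW.
    apply: mulr_ge0; first by rewrite mulr_ge0// ltW.
    by apply: mulr_ge0; [exact: ltW|rewrite addr_ge0// mulr_ge0].
  have h2 : 0 <= 2 * A * c by apply: mulr_ge0; [apply: mulr_ge0 => //|]; exact: ltW.
  by rewrite /C2 !addr_ge0.
set K := (1 + C2 * C) * C * D ^+ 2.
have K0 : 0 < K.
  have : 0 <= C2 * C by rewrite mulr_ge0//; lra.
  by move=> ?; rewrite !mulr_gt0 ?exprn_gt0//; lra.
have ln20 : 0 < ln 2 :> R by rewrite ln_gt0// ltr1n.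
have eta0 : 0 < (1 - t) * ln 2 by rewrite mulr_gt0 ?subr_gt0.
have K40 : 0 < 4 * K by rewrite mulr_gt0.
have [q qP] := log_absorbed eta0 K40.
exists q => sigma sigab sige lam F lam0 Fthin x r Sx r0 FP.
set M := (2 ^ q.+1)%N in sigma sigab sige lam F lam0 Fthin FP.
have M0 : (0 < M)%N by rewrite expn_gt0.
have MR : 0 < M%:R :> R by rewrite ltr0n.
set rho : R := (2 ^+ q.+1)^-1.
have rho0 : 0 < rho by rewrite invr_gt0 exprn_gt0.
have rhoE : rho = M%:R^-1 by rewrite /rho /M natrX.
pose proj j u := a u + sigma j * b u.
have projB j u v : proj j u - proj j v = a (u - v) + sigma j * b (u - v).
  by rewrite /proj aB bB; ring.
have sigS j : `|sigma j| <= Sig.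
  rewrite /Sig; have /andP[s1 s2] := sigab j.
  have := ler_norm be; have := ler_norm (- al); rewrite normrN => h1 h2.
  rewrite ler_norml; have := normr_ge0 al; have := normr_ge0 be; move=> h3 h4.
  by apply/andP; split; lra.
set gain := 2 ^+ q.+1 / (K * q.+2%:R).
have gain0 : 0 < gain by rewrite divr_gt0 ?exprn_gt0// mulr_gt0.
have transv u v s : 0 < s -> rho * s <= `|u - v| -> `|u - v| <= s ->
    \sum_j (`|proj j u - proj j v| < c * rho * s)%R%:R <= C2 * (s / `|u - v|).
  move=> s0 us1 us2; rewrite rhoE.
  under eq_bigr do rewrite projB.
  apply: count_directions => //.
  by apply: lt_le_trans us1; rewrite mulr_gt0.
have spread := @regular_spread R V S D C R0 regS q proj c C2 C20 transv.
pose r1 := Num.min r (R0 / 4).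
have r10 : 0 < r1 by rewrite lt_min r0; lra.
have r1R : r1 <= R0 / 4 by rewrite ge_min lexx orbT.
have r1r : r1 <= r by rewrite ge_min lexx.
have projL j u v : `|proj j u - proj j v| <= c * `|u - v|.
  rewrite projB (le_trans (ler_normD _ _))// normrM.
  have h1 := a_le (u - v).
  have h2 : `|sigma j| * `|b (u - v)| <= Sig * (A * `|u - v|) by apply: ler_pM.
  by rewrite /c; lra.
have rho2 : rho <= 2^-1.
  rewrite /rho lef_pV2 ?posrE ?exprn_gt0// -[leLHS]expr1.
  by apply: ler_weXn2l => //; rewrite ler1n.
have ms m := @multiscale R V S M proj c rho gain (R0 / 4) M0 c0 rho0 rho2 gain0
  projL spread m x r1 Sx r10 r1R.
pose E j := - t * ln (`|lam j| * c * r1 / 3).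
have X0 j : 0 < `|lam j| * c * r1 / 3.
  apply: divr_gt0 => //; apply: mulr_gt0 => //; apply: mulr_gt0 => //.
  by rewrite normr_gt0.
have bound j : exists N, forall m (L : seq R), (N <= m)%N -> (0 < size L)%N ->
   separated (c * rho ^+ m * r1) L ->
   (forall z, z \in L -> exists y, [/\ S y, `|y - x| <= r1 & z = proj j y]) ->
   ln (size L)%:R <= E j + m%:R * (t * (q.+1%:R * ln 2)).
  have [d0 d00 Fc] := Fthin j.
  have [N NP] := @geometric_small R q (`|lam j| * c * r1 / 3) d0 d00.
  exists N => m L Nm L0 Lsep LP.
  have rm0 : 0 < rho ^+ m by rewrite exprn_gt0.
  set d := `|lam j| * c * r1 / 3 * rho ^+ m.
  have dp : 0 < d by rewrite mulr_gt0.
  have [n [cc [Fcov lnn]]] := Fc d dp (NP m Nm).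
  have Ln : (size L <= n)%N.
    rewrite -(size_map (fun z => lam j * z)).
    apply: (@separated_cover_size _ d (`|lam j| * (c * rho ^+ m * r1)) _ _ cc) => //.
    - by rewrite /d; have := X0 j; move/(mulr_gt0 rm0); lra.
    - rewrite /separated pairwise_map; apply: sub_pairwise Lsep => z1 z2 /= h.
      by rewrite -mulrBr normrM ler_pM2l ?normr_gt0.
    - move=> _ /mapP[z /LP[y [Sy yx ->]] ->].
      have [i _ ?] := Fcov _ (FP y j Sy (le_trans yx r1r)).
      by exists i.
  have Lp : 0 < (size L)%:R :> R by rewrite ltr0n.
  apply: (@le_trans _ _ (ln n%:R)).
    by rewrite ler_ln ?posrE ?ler_nat// ltr0n (leq_trans L0).
  have lnr : ln (rho ^+ m) = - (m%:R * (q.+1%:R * ln 2)).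
    rewrite lnXn// /rho lnV ?posrE ?exprn_gt0// lnXn//.
    by rewrite -[ln 2 *+ _]mulr_natl -[LHS]mulr_natl mulrN.
  apply: (le_trans lnn); rewrite /d lnM ?posrE// lnr /E.
  by set l1 := ln _; lra.
have [N NP] := choice bound.
set kap := ln gain - ln 4 in ms.
have kapE : t * (q.+1%:R * ln 2) < kap.
  have : ln gain = q.+1%:R * ln 2 - ln (K * q.+2%:R).
    rewrite /gain ln_div ?posrE ?exprn_gt0//; last exact: mulr_gt0.
    by rewrite lnXn// mulr_natl.
  have h4 : ln (4 * K * q.+2%:R) = ln 4 + ln (K * q.+2%:R).
    by rewrite -[4 * K * _]mulrA lnM ?posrE//; exact: mulr_gt0.
  move: qP; rewrite h4 /kap => h1 ->.
  by move: h1; set l4 := ln 4; set l2 := ln 2; set lK := ln _; lra.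
(* the gain in the exponent per step of the induction, left over after comparing
   with the size d^-t of the covers at scale rho^m *)
set del := kap - t * (q.+1%:R * ln 2).
have del0 : 0 < del by rewrite subr_gt0.
set Etot := \sum_j E j.
pose m1 := (Num.truncn (`|Etot| / (M%:R * del))).+1.
pose m := maxn m1 (\max_j N j).
have mN j : (N j <= m)%N.
  by rewrite leq_max (leq_bigmax (F := N) j) orbT.
have [L [LP Lsum]] := ms m.
have : m%:R * (M%:R * kap) <= Etot + m%:R * (M%:R * (t * (q.+1%:R * ln 2))).
  apply: (le_trans Lsum).
  apply: (@le_trans _ _ (\sum_j (E j + m%:R * (t * (q.+1%:R * ln 2))))).
    apply: ler_sum => j _; have [L0 Lsep Lproj] := LP j.
    exact: NP (mN j) L0 Lsep Lproj.
  by rewrite big_split/= sum_ord_const mulrCA.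
have m1m : m1%:R <= m%:R :> R by rewrite ler_nat leq_maxl.
have := truncnS_gt (`|Etot| / (M%:R * del)).
rewrite -/m1 ltr_pdivrMr ?mulr_gt0// => h1.
have h2 : m1%:R * (M%:R * del) <= m%:R * (M%:R * del).
  by rewrite ler_pM2r ?mulr_gt0.
have := ler_norm Etot; move: h1 h2; rewrite /del.
set mm := m%:R; set m1R := m1%:R; set MM := M%:R; set tq := t * _.
lra.
Qed.

End ThinProjections.

(** * Baire's theorem relative to a compact set *)

Section Baire.
Variables (R : realType) (V : normedModType R) (S : set V).
Hypothesis cS : compact S.

Lemma baire_ball (E : nat -> set V) x (r : R) : (forall i, closed (E i)) ->
  S x -> 0 < r -> (forall y, S y -> `|y - x| <= r -> exists i, E i y) ->
  exists i y s, [/\ S y, 0 < s, `|y - x| + s <= r &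
    forall z, S z -> `|z - y| <= s -> E i z].
Proof.
move=> cE Sx r0 cov; apply: contrapT => no.
pose good (p : V * R) := [/\ S p.1, 0 < p.2 & `|p.1 - x| + p.2 <= r].
pose inner (p' p : V * R) := [/\ S p'.1, 0 < p'.2 & `|p'.1 - p.1| + p'.2 <= p.2].
have step (ip : nat * (V * R)) : exists p', good ip.2 -> inner p' ip.2 /\
    forall z, `|z - p'.1| <= p'.2 -> ~ E ip.1 z.
  case: ip => i [y s]; have [gp|] := pselect (good (y, s)); last by exists (y, s).
  have [Sy s0 ys] := gp; rewrite /= in Sy s0 ys.
  have [z [Sz zy nEz]] : exists z, [/\ S z, `|z - y| <= s / 2 & ~ E i z].
    apply: contrapT => H; apply: no; exists i, y, (s / 2); split => //.
    - by rewrite divr_gt0.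
    - by lra.
    - move=> z Sz zy; apply: contrapT => nE; apply: H; by exists z.
  have : nbhs z (~` E i).
    by apply: open_nbhs_nbhs; split => //; exact: closed_openC.
  move=> /nbhs_closedballP[e eE].
  have e0 : 0 < e%:num by [].
  exists (z, Num.min e%:num (s / 2)) => _ /=; split.
    split => //=; first by rewrite lt_min e0 divr_gt0.
    have : Num.min e%:num (s / 2) <= s / 2 by rewrite ge_min lexx orbT.
    by move: zy; lra.
  move=> u uz; apply: eE; rewrite closed_ballE// /closed_ball_/= distrC.
  by apply: (le_trans uz); rewrite ge_min lexx.
have [f fP] := choice step.
pose p := fix p n := if n is m.+1 then f (m, p m) else (x, r).
have gp n : good (p n).
  elim: n => [|n IH]; first by split => //=; rewrite subrr normr0 add0r.
  have [[Sp p0 pp] _] := fP (n, p n) IH; rewrite /= in Sp p0 pp.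
  have [_ _ h] := IH; split => //.
  rewrite -(subrKA (p n).1).
  have := ler_normD ((p n.+1).1 - (p n).1) ((p n).1 - x); rewrite /=.
  by move: h pp; lra.
have pin n := (fP (n, p n) (gp n)).1.
have pout n := (fP (n, p n) (gp n)).2.
have pnest n k : `|(p (k + n)%N).1 - (p n).1| + (p (k + n)%N).2 <= (p n).2.
  elim: k => [|k IH]; first by rewrite add0n subrr normr0 add0r.
  rewrite addSn; have [_ _] := pin (k + n)%N; rewrite -/(p (k + n).+1)/=.
  set u := (f (_, p (k + n)%N)) => h.
  have := ler_normD (u.1 - (p (k + n)%N).1) ((p (k + n)%N).1 - (p n).1).
  rewrite subrKA; move: h IH; lra.
have [|y [Sy cy]] := cS (F := (fun n => (p n).1) @ \oo) _ _.
  by exists 0%N => // n _; have [] := gp n.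
have yp n : `|y - (p n).1| <= (p n).2.
  have cl : closed (closed_ball_ Num.norm (p n).1 (p n).2) by exact: closed_closed_ball_.
  suff : closed_ball_ Num.norm (p n).1 (p n).2 y by rewrite /closed_ball_/= distrC.
  apply: cl => B yB; apply: cy => //.
  exists n => // m /= nm; rewrite /closed_ball_/= distrC.
  by have := pnest n (m - n)%N; rewrite subnK//; have [_ h _] := gp m; lra.
have [i Ei] := cov y Sy (yp 0%N).
exact: pout i y (yp i.+1) Ei.
Qed.

(** The successive balls are nested, so that the conclusion holds for the first n
coverings simultaneously. *)
Lemma baire_finite (E : nat -> nat -> set V) n : (forall j i, closed (E j i)) ->
  S !=set0 -> (forall j y, S y -> exists i, E j i y) ->
  exists x (r : R) (idx : nat -> nat), [/\ S x, 0 < r &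
    forall j y, (j < n)%N -> S y -> `|y - x| <= r -> E j (idx j) y].
Proof.
move=> cE [x0 Sx0] cov; elim: n => [|n [x [r [idx [Sx r0 H]]]]].
  by exists x0, 1, (fun=> 0%N); split.
have [i [y [s [Sy s0 ys Ei]]]] := baire_ball (cE n) Sx r0 (fun y Sy _ => cov n y Sy).
exists y, s, (fun j => if j == n then i else idx j); split => // j z jn Sz zy.
case: eqP jn => [->|/eqP jn] jn1; first exact: Ei.
apply: H => //; first by rewrite ltn_neqAle jn -ltnS.
rewrite -(subrKA y) (le_trans (ler_normD _ _))//; move: zy ys; lra.
Qed.

End Baire.

(** * Frames and cones of directions in the plane *)

Section Plane.
Variable R : realType.
Implicit Types u v w x : 'rV[R]_2.

Lemma dotr2E u v : dotr u v = u ord0 0 * v ord0 0 + u ord0 1 * v ord0 1.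
Proof. by rewrite /dotr big_ord_recl big_ord1; congr (_ + u _ _ * v _ _); apply: val_inj. Qed.

Definition perp v : 'rV[R]_2 := \row_j (if j == 0 then - v ord0 1 else v ord0 0).

Lemma dotr_perpE u v : dotr u (perp v) = u ord0 1 * v ord0 0 - u ord0 0 * v ord0 1.
Proof. by rewrite dotr2E !mxE/=; ring. Qed.

Lemma dotrBl u v w : dotr (u - v) w = dotr u w - dotr v w.
Proof. by rewrite !dotr2E !mxE; ring. Qed.

Lemma coord_le_norm u i : `|u ord0 i| <= `|u|.
Proof.
rewrite [leRHS]/Num.norm/= mx_normrE.
exact: (le_bigmax _ (fun p => `|u p.1 p.2|) (ord0, i)).
Qed.

Lemma norm_le_coord u (c : R) : `|u ord0 0| <= c -> `|u ord0 1| <= c -> `|u| <= c.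
Proof.
move=> h0 h1; rewrite [leLHS]/Num.norm/= mx_normrE.
apply: bigmax_le; first exact: le_trans h0.
move=> [i j] _ /=; rewrite (ord1 i).
by case: j => [[|[|//]]] j2; [move: h0|move: h1]; congr (`|u _ _| <= _); apply: val_inj.
Qed.

Lemma dotr_le u v : `|dotr u v| <= 2 * `|v| * `|u|.
Proof.
rewrite dotr2E (le_trans (ler_normD _ _))// !normrM.
have h0 := ler_pM (normr_ge0 _) (normr_ge0 _) (coord_le_norm u 0) (coord_le_norm v 0).
have h1 := ler_pM (normr_ge0 _) (normr_ge0 _) (coord_le_norm u 1) (coord_le_norm v 1).
lra.
Qed.

Lemma norm_perp v : `|perp v| <= `|v|.
Proof.
apply: norm_le_coord; rewrite mxE/= ?normrN; exact: coord_le_norm.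
Qed.

Lemma dotr_self_gt0 v : v != 0 -> 0 < dotr v v.
Proof.
move=> v0; rewrite dotr2E -!expr2 lt_neqAle addr_ge0 ?sqr_ge0// andbT.
apply: contraNneq v0 => /esym/eqP.
rewrite paddr_eq0 ?sqr_ge0// !sqrf_eq0 => /andP[/eqP h0 /eqP h1].
rewrite -normr_le0; apply: norm_le_coord; by rewrite ?h0 ?h1 normr0.
Qed.

Lemma frame_decomp v x u :
  dotr v v * dotr x u = dotr u v * dotr x v + dotr u (perp v) * dotr x (perp v).
Proof. by rewrite !dotr_perpE !dotr2E; ring. Qed.

Lemma frame_norm v u : v != 0 ->
  `|u| <= 4 * `|v| / dotr v v * `|dotr u v| \/
  `|u| <= 4 * `|v| / dotr v v * `|dotr u (perp v)|.
Proof.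
move=> v0; have n0 := dotr_self_gt0 v0.
set a := dotr u v; set b := dotr u (perp v).
have key i : dotr v v * `|u ord0 i| <= `|v| * (`|a| + `|b|).
  rewrite -{1}(gtr0_norm n0) -normrM.
  have e0 : dotr v v * u ord0 0 = a * v ord0 0 - b * v ord0 1.
    by rewrite /a /b dotr_perpE !dotr2E; ring.
  have e1 : dotr v v * u ord0 1 = a * v ord0 1 + b * v ord0 0.
    by rewrite /a /b dotr_perpE !dotr2E; ring.
  have B j k : `|a| * `|v ord0 j| + `|b| * `|v ord0 k| <= `|v| * (`|a| + `|b|).
    have h0 := ler_wpM2l (normr_ge0 a) (coord_le_norm v j).
    have h1 := ler_wpM2l (normr_ge0 b) (coord_le_norm v k).
    lra.
  have [->|->] : i = 0 \/ i = 1.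
    by case: i => [[|[|//]]] ?; [left|right]; apply: val_inj.
    rewrite e0 (le_trans (ler_normB _ _))// !normrM; exact: B.
  rewrite e1 (le_trans (ler_normD _ _))// !normrM; exact: B.
have G c : 0 <= c -> `|v| * (`|a| + `|b|) <= 4 * `|v| * c ->
    `|u| <= 4 * `|v| / dotr v v * c.
  move=> c0 h; rewrite mulrAC ler_pdivlMr//.
  rewrite mulrC -ler_pdivlMl//; apply: norm_le_coord; rewrite ler_pdivlMl//;
  exact: le_trans (key _) h.
have vp := normr_ge0 v.
have [ab|/ltW ba] := leP `|b| `|a|; [left|right]; apply: G => //.
  have := ler_wpM2l vp ab; have := mulr_ge0 vp (normr_ge0 a); lra.
have := ler_wpM2l vp ba; have := mulr_ge0 vp (normr_ge0 b); lra.
Qed.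

(** The vectors whose slope in the frame (v, perp v) lies in ]al, be[; multiplying by
the square of the first coordinate keeps the condition polynomial, hence open.
Strictness excludes a vanishing first coordinate. *)
Definition cone v (al be : R) : set 'rV[R]_2 :=
  [set u | al * dotr u v ^+ 2 < dotr u v * dotr u (perp v) /\
           dotr u v * dotr u (perp v) < be * dotr u v ^+ 2].

Lemma cone_slope v al be u : cone v al be u ->
  dotr u v != 0 /\ al < dotr u (perp v) / dotr u v < be.
Proof.
rewrite /cone/=; set a := dotr u v; set b := dotr u (perp v) => -[h1 h2].
have a0 : a != 0 by apply: contraTneq h1 => ->; rewrite expr0n/= mulr0 mul0r ltxx.
have a2 : 0 < a ^+ 2 by rewrite exprn_even_gt0.
split => //; apply/andP; split; rewrite -(ltr_pM2r a2) (_ : b / a * a ^+ 2 = a * b)//.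
  by field.
by field.
Qed.

End Plane.

(** * Case 1: directions from one point dense in an arc *)

Section Dense.
Variables (R : realType) (S : set 'rV[R]_2) (D C R0 : R).
Hypothesis cS : compact S.
Hypothesis regS : counting_regular S D C R0.

Lemma continuous_dotr (e : 'rV[R]_2) : continuous (fun x => dotr x e).
Proof.
move=> x.
rewrite (_ : (fun x => _) =
  (fun x : 'rV[R]_2 => x ord0 0 * e ord0 0 + x ord0 1 * e ord0 1)); last first.
  by apply/funext => y; rewrite dotr2E.
have cont i : {for x, continuous (fun y : 'rV[R]_2 => y ord0 i * e ord0 i)}.
  apply: (@continuousM _ _ (fun y : 'rV[R]_2 => y ord0 i) (fun=> e ord0 i)).
    exact: coord_continuous.
  exact: cst_continuous.
exact: (continuousD (cont 0) (cont 1)).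
Qed.

Lemma dense_directions_not_thin v (al be t : R) x0 (F : nat -> set R) :
  S x0 -> v != 0 -> al < be -> t < 1 ->
  (forall al' be', al <= al' -> al' < be' -> be' <= be ->
     exists2 q, S q & cone v al' be' (q - x0)) ->
  (forall i, closed (F i)) -> (forall i, box_thin t (F i)) ->
  ~ ([set dotr x1 (x2 - x0) | x1 in S & x2 in S] `<=` \bigcup_i F i).
Proof.
move=> Sx0 v0 albe t1 dense cF thinF cov.
have n0 := dotr_self_gt0 v0.
have vp : 0 < `|v| by rewrite normr_gt0.
set A := 2 * `|v| + 4 * `|v| / dotr v v.
have dA : 0 < 4 * `|v| / dotr v v by rewrite divr_gt0// mulr_gt0.
have A0 : 0 < A by rewrite addr_gt0// mulr_gt0.
have aA u : `|dotr u v| <= A * `|u|.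
  apply: (le_trans (dotr_le u v)); rewrite ler_wpM2r// lerDl; exact: ltW.
have bA u : `|dotr u (perp v)| <= A * `|u|.
  apply: (le_trans (dotr_le u _)); rewrite ler_wpM2r//.
  by have := norm_perp v; rewrite /A; lra.
have abA u : `|u| <= A * `|dotr u v| \/ `|u| <= A * `|dotr u (perp v)|.
  have [h|h] := frame_norm u v0; [left|right]; apply: (le_trans h);
  by rewrite ler_wpM2r// lerDr mulr_ge0.
have [q qP] := no_thin_projections regS (fun u w => dotrBl u w v)
   (fun u w => dotrBl u w (perp v)) A0 aA bA abA albe t1.
have : (0 < 2 ^ q.+1)%N by rewrite expn_gt0.
move: (2 ^ q.+1)%N qP => M qP M0.
have MR : 0 < M%:R :> R by rewrite ltr0n.
(* the j-th direction is chosen in the middle half of the j-th of M equal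
   subintervals of [al, be], so that two directions are separated *)
pose slot (k : R) := al + (be - al) * k / (4 * M%:R).
have slot_lt k k' : k < k' -> slot k < slot k'.
  by move=> kk; rewrite ltrD2l ltr_pM2r ?invr_gt0 ?mulr_gt0// ltr_pM2l// subr_gt0.
have slot0 : slot 0 = al by rewrite /slot mulr0 mul0r addr0.
have slotM : slot (4 * M%:R) = be.
  by rewrite /slot; field; rewrite gt_eqF.
have H (j : 'I_M) : exists x, S x /\ cone v (slot (4 * j%:R + 1)) (slot (4 * j%:R + 3)) (x - x0).
  have jM : j%:R + 1 <= M%:R :> R by rewrite natr1 ler_nat.
  have j0 : 0 <= j%:R :> R by [].
  have [||| x Sx cx] := dense (slot (4 * j%:R + 1)) (slot (4 * j%:R + 3)).
  - by rewrite -slot0 ltW// slot_lt; lra.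
  - by apply: slot_lt; lra.
  - by rewrite -slotM ltW// slot_lt; lra.
  by exists x.
have {H} [p pP] := choice H.
pose e j := p j - x0.
pose sigma j := dotr (e j) (perp v) / dotr (e j) v.
pose lam j := dotr (e j) v / dotr v v.
have sigP j : dotr (e j) v != 0 /\ slot (4 * j%:R + 1) < sigma j < slot (4 * j%:R + 3).
  by have [_ /cone_slope] := pP j.
have eE j x : dotr x (e j) = lam j * (dotr x v + sigma j * dotr x (perp v)).
  apply: (mulfI (lt0r_neq0 n0)); rewrite frame_decomp /lam /sigma.
  have [h _] := sigP j; by field; rewrite h gt_eqF.
pose E j i : set 'rV[R]_2 :=
  if (insub j : option 'I_M) is Some k then [set x | F i (dotr x (e k))] else setT.
have cE j i : closed (E j i).
  rewrite /E; case: insubP => [k _ _|_]; last exact: closedT.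
  by apply: preimage_closed => // z _; exact: continuous_dotr.
have covE j y : S y -> exists i, E j i y.
  move=> Sy; rewrite /E; case: insubP => [k _ _|_]; last by exists 0%N.
  have [|i _ Fi] := cov (dotr y (e k)).
    by exists y => //; exists (p k) => //; have [] := pP k.
  by exists i.
have [x [r [idx [Sx r0 xP]]]] := baire_finite cS M cE (ex_intro _ x0 Sx0) covE.
apply: (qP sigma _ _ lam (fun j => F (idx j)) _ _ x r Sx r0).
- move=> j; have [_ /andP[s1 s2]] := sigP j.
  have jM : j%:R + 1 <= M%:R :> R by rewrite natr1 ler_nat.
  have j0 : 0 <= j%:R :> R by [].
  rewrite -{1}slot0 -slotM (ltW (lt_trans _ s1)) ?(ltW (lt_trans s2 _))//;
  by apply: slot_lt; lra.
- suff G (i j : 'I_M) : (i < j)%N ->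
      (be - al) / 2 * `|i%:R - j%:R| / M%:R <= `|sigma i - sigma j|.
    move=> i j; have [ij|ji|/val_inj->] := ltngtP i j; first exact: G.
      by rewrite distrC [leRHS]distrC; exact: G.
    by rewrite !subrr normr0 mulr0 mul0r.
  move=> ij; have [_ /andP[_ s1]] := sigP i; have [_ /andP[s2 _]] := sigP j.
  have ijR : i%:R + 1 <= j%:R :> R by rewrite natr1 ler_nat.
  rewrite distrC [leRHS]distrC ger0_norm; last by lra.
  apply: le_trans (ler_norm _).
  apply: (@le_trans _ _ (slot (4 * j%:R + 1) - slot (4 * i%:R + 3))); last by lra.
  rewrite [leRHS](_ : _ = (be - al) / M%:R * (j%:R - i%:R - 2^-1)); last first.
    by rewrite /slot; field; rewrite gt_eqF.
  rewrite [leLHS](_ : _ = (be - al) / M%:R * ((j%:R - i%:R) / 2)); last first.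
    by field; rewrite gt_eqF.
  rewrite ler_pM2l ?divr_gt0 ?subr_gt0//; lra.
- by move=> j; rewrite mulf_neq0 ?invr_eq0 ?(gt_eqF n0)//; have [] := sigP j.
- by move=> j; exact: thinF.
- move=> y j Sy yx; rewrite -eE.
  by have := xP j y (ltn_ord j) Sy yx; rewrite /E valK.
Qed.

End Dense.

(** * Negligible sets and Lebesgue density on the line *)

Section RealLine.
Variable R : realType.
Notation mu := (@lebesgue_measure R).

Lemma small_covers_negligible (X : set R) :
  (forall eps : R, 0 < eps -> exists B, [/\ measurable B, X `<=` B & (mu B <= eps%:E)%E]) ->
  mu.-negligible X.
Proof.
move=> H.
have {}H n := H (n.+1%:R^-1) ltac:(by rewrite invr_gt0).
have [B BP] := choice H.
exists (\bigcap_n B n); split.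
- by apply: bigcapT_measurable => n; have [] := BP n.
- apply/eqP; rewrite eq_le measure_ge0 andbT; apply/lee_addgt0Pr => e e0.
  rewrite add0e.
  pose n := Num.truncn e^-1.
  have [mB _ Be] := BP n.
  apply: (@le_trans _ _ (mu (B n))).
    rewrite le_measure ?inE//; last exact: bigcap_inf.
    by apply: bigcapT_measurable => k; have [] := BP k.
  apply: (le_trans Be); rewrite lee_fin -[leRHS]invrK lef_pV2 ?posrE ?invr_gt0//.
  exact/ltW/truncnS_gt.
- by move=> x Xx n _; have [_ XB _] := BP n; exact: XB.
Qed.

(** A cover of F by d^-t balls of radius d pulls back to a cover of X of total
length of order d^(1 - t), which tends to 0. *)
Lemma thin_preimage_negligible (X : set R) (G : R -> R) (c t : R) (F : set R) :
  0 < c -> t < 1 -> box_thin t F ->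
  (forall x y, X x -> X y -> c * `|x - y| <= `|G x - G y|) ->
  (forall x, X x -> F (G x)) -> mu.-negligible X.
Proof.
move=> c0 t1 [d0 d00 thin] GX XF; apply: small_covers_negligible => eps eps0.
(* the scale is d = exp (- s); the second bound makes the total length at most eps *)
pose s := Num.max (1 - ln d0) (4 / c / eps / (1 - t)).
have t10 : 0 < 1 - t by rewrite subr_gt0.
have s1 : 1 - ln d0 <= s by rewrite le_max lexx.
have s2 : 4 / c / eps / (1 - t) <= s by rewrite le_max lexx orbT.
have s0 : 0 < s by apply: lt_le_trans s2; rewrite !divr_gt0.
have [|n [cc [Fcov lnn]]] := thin (expR (- s)) (expR_gt0 _).
  by rewrite -[ltRHS]lnK ?posrE// ltr_expR; lra.
rewrite expRK opprK in lnn.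
set d := expR (- s) in Fcov; have dp : 0 < d := expR_gt0 _.
have H i : exists a, X `&` [set x | `|cc i - G x| <= d] `<=` closed_ball a (2 * d / c).
  have [[a [Xa /= ca]]|no] := pselect (X `&` [set x | `|cc i - G x| <= d] !=set0); last first.
    by exists 0 => x xX; exfalso; apply: no; exists x.
  exists a => x [Xx /= cx]; rewrite closed_ballE ?divr_gt0 ?mulr_gt0// /closed_ball_/=.
  rewrite ler_pdivlMr// mulrC (le_trans (GX _ _ Xa Xx))//.
  rewrite (_ : G a - G x = (cc i - G x) - (cc i - G a)); last by ring.
  by rewrite (le_trans (ler_normB _ _))//; lra.
have {H} [a aP] := choice H.
pose a' k := if insub k is Some i then a i else 0.
have mB k : measurable (closed_ball (a' k) (2 * d / c)).
  exact: measurable_closed_ball.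
exists (\big[setU/set0]_(k < n) closed_ball (a' k) (2 * d / c)); split.
- by apply: bigsetU_measurable.
- move=> x Xx; have [i _ ci] := Fcov _ (XF x Xx).
  suff : (\bigcup_(k < n) closed_ball (a' k) (2 * d / c)) x by rewrite bigcup_mkord.
  exists (i : nat) => //=.
  by rewrite /a' valK; exact: aP.
apply: (@le_trans _ _ (\sum_(k < n) mu (closed_ball (a' k) (2 * d / c)))%E).
  apply: (@content_subadditive _ _ _ mu _ (fun k => closed_ball (a' k) (2 * d / c))) => //.
    by move=> k _; exact: mB.
  by apply: bigsetU_measurable => k _; exact: mB.
have [n0|n0] := posnP n; first by rewrite n0 big_ord0 lee_fin ltW.
under eq_bigr do rewrite lebesgue_measure_closed_ball ?divr_ge0 ?mulr_ge0 ?ltW//.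
rewrite sumEFin lee_fin sum_ord_const.
have nle : n%:R <= expR (t * s) by rewrite -[leLHS]lnK ?posrE ?ltr0n// ler_expR.
have h1 : n%:R * d <= expR (- ((1 - t) * s)).
  rewrite (_ : - ((1 - t) * s) = t * s + - s); last by ring.
  by rewrite expRD ler_pM2r.
have h2 : expR (- ((1 - t) * s)) <= ((1 - t) * s)^-1.
  have z0 : 0 < (1 - t) * s by rewrite mulr_gt0.
  rewrite expRN lef_pV2 ?posrE ?expR_gt0//.
  by apply: le_trans (expR_ge1Dx _); lra.
have h3 : ((1 - t) * s)^-1 <= eps * c / 4.
  rewrite -[leRHS]invrK lef_pV2 ?posrE ?invr_gt0 ?mulr_gt0 ?divr_gt0 ?mulr_gt0//.
  rewrite (_ : (eps * c / 4)^-1 = 4 / c / eps); last by field; rewrite !gt_eqF.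
  by rewrite [leRHS]mulrC -ler_pdivrMr.
have h4 : n%:R * d * 4 <= eps * c.
  by rewrite -ler_pdivlMr//; exact: le_trans h1 (le_trans h2 h3).
rewrite -mulr_natr [leLHS](_ : _ = n%:R * d * 4 / c); last by ring.
by rewrite ler_pdivrMr.
Qed.

(** A gap of length kap (q - x) between x and q would remove the proportion kap / 2
of the ball of centre x and radius q - x. *)
Lemma density_point_no_gap (A : set R) (x kap : R) : measurable A ->
  (mu (A `&` ball x r) * (mu (ball x r))^-1)%E @[r --> 0^'+] --> (1%:E : \bar R) ->
  0 < kap -> exists2 r, 0 < r &
    forall p q, x < p -> p < q -> q < x + r ->
      A `&` `]p, q[ = set0 -> q - p < kap * (q - x).
Proof.
move=> mA dens kap0.
have : \forall r \near (0 : R)^'+, ((1 - kap / 2)%:E < mu (A `&` ball x r) * (mu (ball x r))^-1)%E.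
  by apply: (dens _ (open_ereal_gt' _)); rewrite lte_fin; lra.
rewrite near_withinE => /nbhs_ballP[e /= e0 eP].
exists e => // p q xp pq qe Apq.
rewrite ltNge; apply/negP => gap.
have rho0 : 0 < q - x by lra.
have := eP (q - x); rewrite /ball/= sub0r normrN gtr0_norm// => /(_ ltac:(lra) rho0).
rewrite lebesgue_measure_ball ?ltW// inver mulrn_eq0/= gt_eqF//.
apply/negP; rewrite -leNgt.
pose w := (q - x) + (p - x).
have mB : (mu (A `&` ball x (q - x)) <= w%:E)%E.
  have -> : (w%:E = mu `](x - (q - x))%R, p])%E.
    rewrite lebesgue_measure_itv/= lte_fin ifT; last by lra.
    by rewrite -EFinB /w; congr EFin; ring.
  rewrite le_measure ?inE//.
    apply: measurableI => //; exact: measurable_ball.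
  move=> z [Az]; rewrite ball_itv/= !in_itv/= => /andP[z1 z2].
  rewrite z1/= leNgt; apply/negP => pz.
  have : (A `&` `]p, q[) z by split => //=; rewrite in_itv/= pz; lra.
  by rewrite Apq.
rewrite lee_pdivrMr; last by rewrite mulrn_wgt0.
have wle : w <= (1 - kap / 2) * ((q - x) *+ 2).
  have gap' : kap * (q - x) <= q - p := gap.
  rewrite (_ : (1 - kap / 2) * _ = 2 * (q - x) - kap * (q - x)); last by rewrite mulr2n; field.
  by rewrite /w; lra.
by apply: le_trans mB _; rewrite -EFinM lee_fin.
Qed.

Lemma density_no_gap (A : set R) : measurable A ->
  {ae mu, forall x : R, A x -> forall kap : R, 0 < kap -> exists2 r, 0 < r &
    forall p q, x < p -> p < q -> q < x + r ->
      A `&` `]p, q[ = set0 -> q - p < kap * (q - x)}.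
Proof.
move=> mA; have := lebesgue_density mA.
apply: filter_app; first exact: (ae_filter_ringOfSetsType mu).
apply: aeW => x dens Ax kap.
apply: density_point_no_gap => //.
by rewrite indicE mem_set in dens.
Qed.

End RealLine.

(** * Chords that avoid an interval of slopes *)

Section OneSided.
Variable R : realType.
Notation mu := (@lebesgue_measure R).
Implicit Types A P Q : set R.

Lemma closed_sup_in A : closed A -> A !=set0 -> has_ubound A -> A (sup A).
Proof. by move=> cA A0 Ab; apply: cA; exact: closure_sup. Qed.

Lemma closed_inf_in A : closed A -> A !=set0 -> has_lbound A -> A (inf A).
Proof.
move=> cA A0 Ab; apply: cA => U /nbhs_ballP[e /= e0 eU].
have [a Aa ae] := inf_adherent e0 (conj A0 Ab).
exists a; split => //; apply: eU; rewrite /ball/= distrC ger0_norm.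
  by rewrite ltrBlDl.
by rewrite subr_ge0; exact: ge_inf.
Qed.

(** A discrete intermediate value theorem: p is the last point of P before z, and q
the first point of Q after p. *)
Lemma jump_across_gap A P Q (y z : R) : closed P -> closed Q ->
  (forall a, A a -> y <= a -> a <= z -> P a \/ Q a) ->
  (forall a, y <= a -> P a -> ~ Q a) ->
  P y -> Q z -> y <= z ->
  exists p q, [/\ y <= p /\ q <= z, p < q, P p, Q q & A `&` `]p, q[ = set0].
Proof.
move=> cP cQ PQ disj Py Qz yz.
pose E := P `&` [set a | a <= z]; pose p := sup E.
have cE : closed E by apply: closedI => //; exact: closed_le.
have E0 : E !=set0 by exists y.
have Eb : has_ubound E by exists z => a [].
have [Pp pz] : E p by exact: closed_sup_in.
have yp : y <= p by apply: ub_le_sup.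
pose G := Q `&` [set a | p <= a]; pose q := inf G.
have cG : closed G by apply: closedI => //; exact: closed_ge.
have G0 : G !=set0 by exists z.
have Gb : has_lbound G by exists p => a [].
have [Qq pq] : G q by exact: closed_inf_in.
have qz : q <= z by apply: ge_inf.
exists p, q; split => //.
  rewrite lt_neqAle pq andbT; apply/eqP => pqE; move: Qq; rewrite -pqE.
  exact: disj.
apply/seteqP; split => // a [Aa]; rewrite /= in_itv/= => /andP[pa aq].
have [Pa|Qa] := PQ a Aa (ltW (le_lt_trans yp pa)) (ltW (lt_le_trans aq qz)).
  have : a <= p by apply: ub_le_sup => //; split => //=; rewrite (le_trans (ltW aq)).
  by rewrite leNgt pa.
have : q <= a by apply: ge_inf => //; split => //=; exact: ltW.
by rewrite leNgt aq.
Qed.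

Lemma closed_sublevel A (phi : R -> R) (L : R) : closed A ->
  (forall a b, A a -> A b -> `|phi a - phi b| <= L * `|a - b|) ->
  closed (A `&` [set a | phi a <= 0]).
Proof.
move=> cA phiL a ha.
have Aa : A a.
  by apply: cA => U /ha[b [[Ab _] Ub]]; exists b.
split => //=; rewrite leNgt; apply/negP => pa.
have L0 : 0 < `|L| + 1 by rewrite ltr_wpDl.
have e0 : 0 < phi a / (`|L| + 1) by rewrite divr_gt0.
have [b [[Ab /= pb]]] := ha _ (nbhsx_ballx a _ e0).
rewrite /ball/= ltr_pdivlMr// mulrC => ab.
have := phiL a b Aa Ab; apply/negP; rewrite -ltNge.
apply: (@le_lt_trans _ _ ((`|L| + 1) * `|a - b|)).
  by rewrite ler_wpM2r//; have := ler_norm L; lra.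
by apply: lt_le_trans ab _; have := ler_norm (phi a - phi b); lra.
Qed.

Variables (A : set R) (h : R -> R) (L al be : R).
Hypothesis cA : closed A.
Hypothesis hL : forall x y, A x -> A y -> `|h x - h y| <= L * `|x - y|.
Hypothesis L0 : 0 <= L.
Hypothesis albe : al < be.
Hypothesis avoid : forall x y, A x -> A y -> x < y ->
  h y - h x <= al * (y - x) \/ be * (y - x) <= h y - h x.

(** If the slope from x is at most al at p and at least be at q, or conversely, then
as h is L-Lipschitz the distance q - p is at least a fixed proportion of q - x.
By [jump_across_gap], two chords on different sides would produce such p and q
with no point of A in between, against density at x. *)
Lemma one_sided_at x : A x ->
  (forall kap : R, 0 < kap -> exists2 r, 0 < r &
    forall p q, x < p -> p < q -> q < x + r ->
      A `&` `]p, q[ = set0 -> q - p < kap * (q - x)) ->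
  exists2 r, 0 < r &
   (forall y, A y -> x < y -> y < x + r -> h y - h x <= al * (y - x)) \/
   (forall y, A y -> x < y -> y < x + r -> be * (y - x) <= h y - h x).
Proof.
move=> Ax dens.
set K : R := L + `|al| + `|be|.
have K0 : 0 <= K by rewrite !addr_ge0.
have KD0 : 0 < K + (be - al) by move: albe; lra.
have [|r r0 rP] := dens ((be - al) / (K + (be - al))).
  by rewrite divr_gt0// subr_gt0.
exists r => //; apply: contrapT => /not_orP[n1 n2].
have [z [Az xz zr zal]] : exists z, [/\ A z, x < z, z < x + r & h z - h x <= al * (z - x)].
  apply: contrapT => no; apply: n2 => y Ay xy yr.
  by have [h1|//] := avoid Ax Ay xy; exfalso; apply: no; exists y.
have [y [Ay xy yr ybe]] : exists y, [/\ A y, x < y, y < x + r & be * (y - x) <= h y - h x].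
  apply: contrapT => no; apply: n1 => w Aw xw wr.
  by have [//|h1] := avoid Ax Aw xw; exfalso; apply: no; exists w.
pose P := A `&` [set a | h a - h x - al * (a - x) <= 0].
pose Q := A `&` [set a | be * (a - x) - (h a - h x) <= 0].
have cP : closed P.
  apply: (@closed_sublevel _ (fun a => h a - h x - al * (a - x)) (L + `|al|)) => // a b Aa Ab.
  rewrite (_ : _ - _ = (h a - h b) - al * (a - b)); last by ring.
  by rewrite (le_trans (ler_normB _ _))// mulrDl lerD ?hL// normrM.
have cQ : closed Q.
  apply: (@closed_sublevel _ (fun a => be * (a - x) - (h a - h x)) (L + `|be|)) => // a b Aa Ab.
  rewrite (_ : _ - _ = be * (a - b) - (h a - h b)); last by ring.
  by rewrite (le_trans (ler_normB _ _))// addrC mulrDl lerD ?hL// normrM.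
have key p q : x < p -> p < q -> q < x + r -> A `&` `]p, q[ = set0 ->
    (be - al) * (p - x) <= K * (q - p) -> False.
  move=> xp pq qr Apq; have := rP p q xp pq qr Apq.
  rewrite mulrAC ltr_pdivlMr// => h1 h2; lra.
have PQ w a : x < w -> A a -> w <= a -> P a \/ Q a.
  move=> xw Aa wa; have [h1|h1] := avoid Ax Aa (lt_le_trans xw wa); [left|right];
  by split => //=; lra.
have disj w a : x < w -> w <= a -> P a -> ~ Q a.
  move=> xw wa [_ /= h1] [_ /= h2].
  have : 0 < (be - al) * (a - x) by rewrite mulr_gt0// subr_gt0// (lt_le_trans xw).
  lra.
have Lpq p q : P p \/ Q p -> P q \/ Q q -> p < q -> `|h q - h p| <= L * (q - p).
  move=> Pp Pq pq.
  have Ap : A p by case: Pp => -[].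
  have Aq : A q by case: Pq => -[].
  by have := hL Aq Ap; rewrite [X in L * X]gtr0_norm// subr_gt0.
have Pz : P z by split => //=; move: zal; lra.
have Qy : Q y by split => //=; move: ybe; lra.
have [yz|zy] := leP y z.
  have QP a : A a -> y <= a -> a <= z -> Q a \/ P a.
    by move=> Aa ya _; have [] := PQ y a xy Aa ya; [right|left].
  have dQP a : y <= a -> Q a -> ~ P a by move=> ya Qa Pa; exact: disj xy ya Pa Qa.
  have [p [q [[yp qz] pq [Ap Qp] [Aq Pq] gap]]] :=
    jump_across_gap cQ cP QP dQP Qy Pz yz.
  rewrite /= in Qp Pq.
  apply: (key p q) => //; [exact: lt_le_trans yp|exact: le_lt_trans zr|].
  have := Lpq p q (or_intror (conj Ap Qp)) (or_introl (conj Aq Pq)) pq.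
  rewrite ler_norml => /andP[h1 _].
  have qp0 : 0 <= q - p by rewrite subr_ge0 ltW.
  have h2 := ler_wpM2r qp0 (ler_norm al).
  have := mulr_ge0 (normr_ge0 be) qp0 => h3.
  rewrite /K; lra.
have PQ' a : A a -> z <= a -> a <= y -> P a \/ Q a.
  by move=> Aa za _; exact: PQ xz Aa za.
have dPQ a : z <= a -> P a -> ~ Q a by move=> za; exact: disj xz za.
have [p [q [[zp qy] pq [Ap Pp] [Aq Qq] gap]]] :=
  jump_across_gap cP cQ PQ' dPQ Pz Qy (ltW zy).
rewrite /= in Pp Qq.
apply: (key p q) => //; [exact: lt_le_trans zp|exact: le_lt_trans yr|].
have := Lpq p q (or_introl (conj Ap Pp)) (or_intror (conj Aq Qq)) pq.
rewrite ler_norml => /andP[_ h1].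
have qp0 : 0 <= q - p by rewrite subr_ge0 ltW.
have := ler_wpM2r qp0 (ler_norm (- be)); rewrite normrN => h2.
have := mulr_ge0 (normr_ge0 al) qp0 => h3.
rewrite /K; lra.
Qed.

(** Cut A according to the side, to the radius 1 / (n + 1) up to which
[one_sided_at] holds, and to cells of that length: within one piece, every chord
is a short chord from its left endpoint. *)
Lemma one_sided_piece : ~ mu.-negligible A ->
  exists A', [/\ A' `<=` A, ~ mu.-negligible A' &
    (forall x y, A' x -> A' y -> x < y -> h y - h x <= al * (y - x)) \/
    (forall x y, A' x -> A' y -> x < y -> be * (y - x) <= h y - h x)].
Proof.
move=> nA; apply: contrapT => no; apply: nA.
have mA : measurable A by exact: closed_measurable.
have [N [mN N0 Nsub]] := density_no_gap mA.
pose Dm (n : nat) := [set x | A x /\ forall y, A y -> x < y ->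
  y < x + n.+1%:R^-1 -> h y - h x <= al * (y - x)].
pose Dp (n : nat) := [set x | A x /\ forall y, A y -> x < y ->
  y < x + n.+1%:R^-1 -> be * (y - x) <= h y - h x].
pose cell (n : nat) (k : int) := [set x : R | Num.floor (x / n.+1%:R^-1) = k].
pose piece (D : nat -> set R) (nk : nat * int) := D nk.1 `&` cell nk.1 nk.2.
have cellP n k x y : cell n k x -> cell n k y -> x < y -> y < x + n.+1%:R^-1.
  move=> cx cy xy.
  have : `|y - x| < n.+1%:R^-1.
    by apply: floor_eq_dist; rewrite ?invr_gt0//; rewrite /cell/= in cx cy; rewrite cx cy.
  by rewrite gtr0_norm ?subr_gt0// ltrBlDl.
have negm nk : mu.-negligible (piece Dm nk).
  apply: contrapT => nn; apply: no; exists (piece Dm nk); split => //.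
    by move=> x [[]].
  left => x y [[Ax xP] cx] [[Ay _] cy] xy; apply: xP => //; exact: cellP cx cy xy.
have negp nk : mu.-negligible (piece Dp nk).
  apply: contrapT => nn; apply: no; exists (piece Dp nk); split => //.
    by move=> x [[]].
  right => x y [[Ax xP] cx] [[Ay _] cy] xy; apply: xP => //; exact: cellP cx cy xy.
pose W (D : nat -> set R) (i : nat) := if unpickle i is Some nk then piece D nk else set0.
have negW D : (forall nk, mu.-negligible (piece D nk)) -> mu.-negligible (\bigcup_i W D i).
  move=> H; apply: negligible_bigcup => i; rewrite /W; case: unpickle => // *.
  exact: negligible_set0.
have inW D n x : D n x -> (\bigcup_i W D i) x.
  move=> Dx; exists (pickle (n, Num.floor (x / n.+1%:R^-1) : int)) => //.
  by rewrite /W pickleK.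
apply: (@negligibleS _ _ _ mu (N `|` (\bigcup_i W Dm i `|` \bigcup_i W Dp i))).
  move=> x Ax; have [Nx|nNx] := pselect (N x); first by left.
  right; have dx : forall kap : R, 0 < kap -> exists2 r, 0 < r &
    forall p q, x < p -> p < q -> q < x + r ->
      A `&` `]p, q[ = set0 -> q - p < kap * (q - x).
    apply: contrapT => nd; apply: nNx; apply: Nsub => /= H; exact: nd (H Ax).
  have [r r0 rP] := one_sided_at Ax dx.
  pose n := Num.truncn r^-1.
  have nr : n.+1%:R^-1 <= r.
    rewrite -[leRHS]invrK lef_pV2 ?posrE ?invr_gt0//; exact/ltW/truncnS_gt.
  case: rP => rP; [left|right]; apply: (inW _ n); split => // y Ay xy yn;
  by apply: rP => //; apply: lt_le_trans yn _; rewrite lerD2l.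
apply: negligibleU; first by exists N; split.
by apply: negligibleU; apply: negW.
Qed.

End OneSided.

(** * Case 2: directions nowhere dense *)

(** The D^k / C separated points of a ball, D >= 2, are mapped to points whose
neighbourhoods of radius comparable to r / 2^k are disjoint: their total length
is bounded below uniformly in k.  For large k they all lie in a given open neighbourhood of the
compact image, which therefore cannot have small measure. *)
Lemma image_not_negligible (R : realType) (V : normedModType R) (S : set V)
    (D C R0 : R) (p : V -> R) (c : R) x (r : R) :
  compact S -> counting_regular S D C R0 -> continuous p -> 0 < c ->
  S x -> 0 < r -> r <= R0 ->
  let K := S `&` [set y | `|y - x| <= r] in
  (forall u v, K u -> K v -> c * `|u - v| <= `|p u - p v|) ->
  ~ (@lebesgue_measure R).-negligible (p @` K).
Proof.
move=> cS regS cp c0 Sx r0 rR K pK [N [mN N0 KN]].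
have [D2 C1 R00 reg] := regS.
set mu := @lebesgue_measure R in N0.
have C0 : 0 < C by lra.
have eps0 : 0 < c * r / C by rewrite divr_gt0// mulr_gt0.
have Nfin : (mu N < +oo)%E by rewrite N0.
have [U [oU NU UN]] := lebesgue_regularity_outer mN Nfin eps0.
have muU : (mu U < (c * r / C)%:E)%E.
  rewrite -(setDUK NU) (le_lt_trans (measureU2 _ _ _))//.
    by apply: measurableD => //; exact: open_measurable.
  by rewrite [X in (X + _)%E]N0 add0e.
have cK : compact K.
  apply: compact_closedI => //.
  rewrite (_ : [set _ | _] = closed_ball_ Num.norm x r); first exact: closed_closed_ball_.
  by apply/seteqP; split => y /=; rewrite /closed_ball_/= distrC.
have cA : compact (p @` K).
  by apply: continuous_compact => //; exact: continuous_subspaceT.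
pose dl k : R := c * (r / 2 ^+ k) / 2.
have dl0 k : 0 < dl k by rewrite !divr_gt0 ?mulr_gt0 ?divr_gt0 ?exprn_gt0.
have [k _ /(_ k (leqnn k)) kP] : \forall k \near \oo, p @` K `<=` [set a | ball a (dl k) `<=` U].
  move/compact_near_coveringP: cA; apply => a Ka.
  have : nbhs a U by apply: open_nbhs_nbhs; split => //; exact: NU (KN _ Ka).
  move=> /nbhs_ballP[e /= e0 eU].
  have [M MP] := @geometric_small R 0 (c * r) e e0.
  exists (ball a (e / 2), [set k | (M <= k)%N]).
    split; first by apply: nbhsx_ballx; rewrite divr_gt0.
    by exists M.
  move=> [b k] [/= ab Mk] z bz; apply: eU.
  rewrite (splitr e); apply: (ball_triangle ab).
  apply: le_ball bz; rewrite /dl ler_pM2r// ?invr_gt0//.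
  have := MP k Mk; rewrite expr1 exprVn mulrA; exact: ltW.
have [_ [l [lS lsep lsize]]] := reg x r k Sx r0 rR.
pose y i := tnth (in_tuple l) i.
have yK i : K (y i) by have [] := lS _ (mem_tnth i (in_tuple l)).
pose B i := ball (p (y i)) (dl k).
have Bdisj : trivIset setT B.
  apply/trivIsetP => i j _ _ ij; apply/seteqP; split => // z [].
  rewrite /B /ball/= => iz jz.
  have h1 : `|p (y i) - p (y j)| < 2 * dl k.
    rewrite (_ : _ - _ = (p (y i) - z) - (p (y j) - z)); last by ring.
    by rewrite (le_lt_trans (ler_normB _ _))//; lra.
  have h2 := pK _ _ (yK i) (yK j).
  have h3 : r / 2 ^+ k <= `|y i - y j|.
    rewrite /y !(tnth_nth 0)/=; have /(pairwiseP 0) P := lsep.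
    have [lt|lt|/val_inj e] := ltngtP i j; last by rewrite e eqxx in ij.
      by apply: P; rewrite ?inE.
    by rewrite distrC; apply: P; rewrite ?inE.
  have h4 : c * (r / 2 ^+ k) <= c * `|y i - y j| by rewrite ler_pM2l.
  by move: h1; rewrite /dl => h1; exfalso; lra.
have mB i : measurable (B i) by exact: measurable_ball.
have : (mu (\big[setU/set0]_(i < size l) B i) <= mu U)%E.
  rewrite le_measure ?inE//.
  - by apply: bigsetU_measurable => i _; exact: mB.
  - exact: open_measurable.
  apply: (big_ind (fun X => X `<=` U)) => // [X Y XU YU|i _]; first by rewrite subUset.
  by apply: kP; exists (y i).
have -> : mu (\big[setU/set0]_(i < size l) B i) = (\sum_(i < size l) mu (B i))%E.
  exact: (@measure_bigsetU_ord _ _ _ (@lebesgue_measure R) (size l) xpredT B mB Bdisj).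
under eq_bigr => i _ do rewrite /mu /B lebesgue_measure_ball ?ltW//.
rewrite sumEFin sum_ord_const; apply/negP; rewrite -ltNge.
apply: (lt_le_trans muU); rewrite lee_fin /dl.
rewrite -[_ *+ 2]mulr_natr divfK ?pnatr_eq0// ler_pdivrMr//.
have pk : 0 < 2 ^+ k :> R by rewrite exprn_gt0.
have : 2 ^+ k <= C * (size l)%:R.
  by apply: le_trans lsize; apply: lerXn2r; rewrite ?nnegrE//; lra.
move=> h; rewrite (_ : _ * _ * C = (c * r) / 2 ^+ k * (C * (size l)%:R)); last first.
  by field; rewrite gt_eqF.
rewrite -[leLHS](divfK (lt0r_neq0 pk)) ler_pM2l// divr_gt0// mulr_gt0//.
Qed.

Section Clusters.
Variables (R : realType) (S : set 'rV[R]_2).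
Hypothesis cS : compact S.

Lemma cone_sub v (al be al' be' : R) : al <= al' -> be' <= be ->
  cone v al' be' `<=` cone v al be.
Proof.
move=> h1 h2 u [u1 u2]; have s0 : 0 <= dotr u v ^+ 2 by rewrite sqr_ge0.
split; [apply: le_lt_trans u1|apply: lt_le_trans u2 _]; exact: ler_wpM2r.
Qed.

Lemma closed_avoid_cone v (al be : R) :
  closed [set z | forall q, S q -> ~ cone v al be (q - z)].
Proof.
rewrite (_ : [set _ | _] = \bigcap_(q in S) [set z | ~ cone v al be (q - z)]); last first.
  by apply/seteqP; split.
apply: closed_bigI => q Sq.
pose P z := dotr q v - dotr z v; pose B z := dotr q (perp v) - dotr z (perp v).
have cB' (f g : 'rV[R]_2 -> R) : continuous f -> continuous g -> continuous (fun z => f z - g z).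
  by move=> cf cg z; exact: (continuousB (cf z) (cg z)).
have cM (f g : 'rV[R]_2 -> R) : continuous f -> continuous g -> continuous (fun z => f z * g z).
  by move=> cf cg z; exact: (continuousM (cf z) (cg z)).
have cc (k : R) : continuous (fun _ : 'rV[R]_2 => k) by exact: cst_continuous.
have cP : continuous P by apply: cB' => //; exact: continuous_dotr.
have cB : continuous B by apply: cB' => //; exact: continuous_dotr.
pose f1 z := P z * B z - al * (P z * P z).
pose f2 z := be * (P z * P z) - P z * B z.
have c1 : continuous f1 by apply: (cB'); [exact: cM|apply: (cM); [exact: cc|exact: cM]].
have c2 : continuous f2 by apply: (cB'); [apply: (cM); [exact: cc|exact: cM]|exact: cM].
rewrite (_ : [set _ | _] = f1 @^-1` [set a | a <= 0] `|` f2 @^-1` [set a | a <= 0]).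
  apply: closedU.
    by apply: preimage_closed => [z _|]; [exact: c1|exact: closed_le].
  by apply: preimage_closed => [z _|]; [exact: c2|exact: closed_le].
apply/seteqP; split => z; rewrite /= /cone /f1 /f2 /P /B/= !dotrBl !expr2.
  move=> nc; have [h|h] := leP (_ - al * _) 0; [by left|right].
  by rewrite leNgt; apply/negP => h2; apply: nc; split; lra.
by case=> h [h1 h2]; lra.
Qed.

Hypothesis missing : forall x v (al be : R), S x -> v != 0 -> al < be ->
  exists al' be', [/\ al <= al', al' < be', be' <= be &
    forall q, S q -> ~ cone v al' be' (q - x)].

(** Baire's theorem for the countably many cones with rational slopes. *)
Lemma uniformly_missing x v (r al be : R) : S x -> 0 < r -> v != 0 -> al < be ->
  exists y s al' be', [/\ S y /\ 0 < s, `|y - x| + s <= r,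
    al <= al' /\ be' <= be, al' < be' &
    forall z q, S z -> `|z - y| <= s -> S q -> ~ cone v al' be' (q - z)].
Proof.
move=> Sx r0 v0 albe.
pose ok (ab : rat * rat) := [&& al <= ratr ab.1, ratr ab.1 < ratr ab.2 :> R & ratr ab.2 <= be].
pose E i := if unpickle i is Some ab then
  (if ok ab then [set z | forall q, S q -> ~ cone v (ratr ab.1) (ratr ab.2) (q - z)] else set0)
  else set0.
have cE i : closed (E i).
  rewrite /E; case: unpickle => [ab|]; last exact: closed0.
  case: (ok ab); [exact: closed_avoid_cone|exact: closed0].
have [y Sy _|i [y [s [Sy s0 ys]]]] := baire_ball cS cE Sx r0.
  have [al' [be' [h1 h2 h3 hq]]] := missing Sy v0 albe.
  have [b] := rat_in_itvoo h2; rewrite in_itv/= => /andP[b1 b2].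
  have [a] := rat_in_itvoo b1; rewrite in_itv/= => /andP[a1 a2].
  exists (pickle (a, b)); rewrite /E pickleK /ok/= a2.
  rewrite (le_trans h1 (ltW a1)) (le_trans (ltW b2) h3)/= => q Sq cq.
  by apply: (hq q Sq); apply: cone_sub cq; exact: ltW.
rewrite /E; case: unpickle => [[a b]|]; last first.
  by move=> /(_ y Sy); rewrite subrr normr0 => /(_ (ltW s0)).
case: ifP => [/and3P[/= h1 h2 h3] H|_]; last first.
  by move=> /(_ y Sy); rewrite subrr normr0 => /(_ (ltW s0)).
by exists y, s, (ratr a), (ratr b); split => // z q Sz zy Sq; exact: H.
Qed.

End Clusters.

(** H / X and H' / d are slopes of two chords.  Both lie in [- L, 1 / (2 L)], so their
product is at least - 1 / 2.  This is where the chords are seen to make an angle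
bounded away from a right angle. *)
Lemma prod_lower_bound (R : realType) (X d L H H' : R) : 0 < X -> 0 < d -> 0 < L ->
  `|H| <= L * X -> `|H'| <= L * d -> 2 * L * H <= X -> 2 * L * H' <= d ->
  - (X * d / 2) <= H * H'.
Proof.
move=> X0 d0 L0; rewrite !ler_norml => /andP[h1 h2] /andP[h3 h4] h5 h6.
have key (Y e K K' : R) : 0 < Y -> 0 < e -> 0 <= K -> K' <= 0 -> - (L * e) <= K' ->
    2 * L * K <= Y -> - (Y * e / 2) <= K * K'.
  move=> Y0 e0 K0 K'0 a1 a2.
  have : K * (- K') <= K * (L * e) by rewrite ler_wpM2l//; lra.
  have : 2 * L * K * e <= Y * e by rewrite ler_pM2r.
  lra.
have XD : 0 < X * d by rewrite mulr_gt0.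
have [H0|/ltW H0] := leP 0 H; have [H'0|/ltW H'0] := leP 0 H'.
- have := mulr_ge0 H0 H'0; lra.
- exact: (key X d H H').
- have := key d X H' H d0 X0 H'0 H0 h1 h6; lra.
- have : 0 <= (- H) * (- H') by rewrite mulr_ge0// oppr_ge0.
  lra.
Qed.

Section ChordCluster.
Variables (R : realType) (S : set 'rV[R]_2) (D C R0 : R).
Hypothesis cS : compact S.
Hypothesis regS : counting_regular S D C R0.
Notation mu := (@lebesgue_measure R).

Hypothesis missing : forall x v (al be : R), S x -> v != 0 -> al < be ->
  exists al' be', [/\ al <= al', al' < be', be' <= be &
    forall q, S q -> ~ cone v al' be' (q - x)].

(** If the chords avoid the slopes in ]al, be[ then, in the frame whose second axis
has the middle slope (al + be) / 2, the second coordinate of a chord is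
controlled by the first one. *)
Lemma lipschitz_frame : S !=set0 -> exists y s L v, [/\ S y, 0 < s, 0 < L, v != 0 &
  forall u w, S u -> S w -> `|u - y| <= s -> `|w - y| <= s ->
    `|dotr (u - w) (perp v)| <= L * `|dotr (u - w) v|].
Proof.
move=> [x0 Sx0].
pose v0 : 'rV[R]_2 := \row_j (if j == 0 then 1 else 0).
have v00 : v0 != 0.
  by apply/eqP => /rowP/(_ 0); rewrite !mxE/= => /eqP; rewrite oner_eq0.
have [y [s [al [be [[Sy s0] _ _ albe miss]]]]] :=
  uniformly_missing cS missing Sx0 (ltr01 : (0 : R) < 1) v00 (ltr01 : (0 : R) < 1).
pose c := (al + be) / 2; pose eta := (be - al) / 2.
have eta0 : 0 < eta by rewrite divr_gt0// subr_gt0.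
pose v : 'rV[R]_2 := \row_j (if j == 0 then - c else 1).
have v_neq0 : v != 0.
  by apply/eqP => /rowP/(_ 1); rewrite !mxE/= => /eqP; rewrite oner_eq0.
pose L := (1 + c ^+ 2) / eta + `|c|.
have L0 : 0 < L.
  by rewrite ltr_pwDl// divr_gt0// ltr_pwDl// sqr_ge0.
exists y, s, L, v; split => // u w Su Sw uy wy.
have [v00E v01E] : v0 ord0 0 = 1 /\ v0 ord0 1 = 0 by rewrite !mxE.
have [vE0 vE1] : v ord0 0 = - c /\ v ord0 1 = 1 by rewrite !mxE.
have := miss w u Sw wy Su; move: (u - w) => d.
rewrite /cone/= !dotr_perpE !dotr2E v00E v01E vE0 vE1.
set a := d ord0 0; set b := d ord0 1.
move=> nc.
have key : eta * `|a| <= `|b - c * a|.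
  have [->|a0] := eqVneq a 0; first by rewrite normr0 mulr0.
  rewrite -ler_pdivlMr ?normr_gt0// -normf_div.
  have -> : (b - c * a) / a = b / a - c by field.
  have a2 : 0 < a ^+ 2 by rewrite exprn_even_gt0.
  rewrite leNgt; apply/negP; rewrite ltr_norml => /andP[h1 h2].
  apply: nc.
  have e1 : al < b / a by rewrite /c /eta in h1 h2 *; lra.
  have e2 : b / a < be by rewrite /c /eta in h1 h2 *; lra.
  have -> : (a * 1 + b * 0) = a by ring.
  have -> : a * (b * 1 - a * 0) = b / a * a ^+ 2 by field.
  by rewrite !ltr_pM2r.
have -> : b * - c - a * 1 = - (a * (1 + c ^+ 2) + c * (b - c * a)) by ring.
have -> : a * - c + b * 1 = b - c * a by ring.
rewrite normrN (le_trans (ler_normD _ _))// (normrM a) (normrM c) /L [leRHS]mulrDl lerD2r.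
rewrite [X in _ * X <= _]ger0_norm; last by rewrite addr_ge0// sqr_ge0.
rewrite mulrAC ler_pdivlMr// [leLHS]mulrC mulrA.
have c20 : 0 <= 1 + c ^+ 2 by rewrite addr_ge0// sqr_ge0.
by rewrite [leLHS]mulrC; apply: ler_wpM2l.
Qed.

(** The set A' lies in the first coordinate axis of the frame of [lipschitz_frame],
and phi lifts it to S.  The second family of missing slopes is sought in
]- 1 / (2 L), 1 / (2 L)[, the middle of the range [- L, L] of slopes, for the sake of
[prod_lower_bound]. *)
Lemma expanding_chord : S !=set0 ->
  exists (x0 x2 : 'rV[R]_2) (A' : set R) (phi : R -> 'rV[R]_2) (c : R),
  [/\ S x0, S x2, 0 < c, ~ mu.-negligible A' &
   (forall x, A' x -> S (phi x)) /\
   (forall x y, A' x -> A' y ->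
     c * `|x - y| <= `|dotr (phi x) (x2 - x0) - dotr (phi y) (x2 - x0)|)].
Proof.
move=> S0; have [y1 [s1 [L [v [Sy1 s10 L0 v0 lip]]]]] := lipschitz_frame S0.
have n0 := dotr_self_gt0 v0.
have L20 : 0 < (2 * L)^-1 by rewrite invr_gt0 mulr_gt0.
have ab0 : - (2 * L)^-1 < (2 * L)^-1 by lra.
have [y [s [al [be [[Sy s0] ys [al1 be1] albe miss]]]]] :=
  uniformly_missing cS missing Sy1 s10 v0 ab0.
have [D2 C1 R00 _] := regS.
pose r := Num.min s R0.
have r0 : 0 < r by rewrite lt_min s0.
have rR : r <= R0 by rewrite ge_min lexx orbT.
have rs : r <= s by rewrite ge_min lexx.
pose K := S `&` [set z | `|z - y| <= r].
have K1 u : K u -> S u /\ `|u - y1| <= s1.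
  move=> [Su /= uy]; split => //.
  rewrite -(subrKA y) (le_trans (ler_normD _ _))//; lra.
have lipK u w : K u -> K w -> `|dotr (u - w) (perp v)| <= L * `|dotr (u - w) v|.
  by move=> /K1[Su uy] /K1[Sw wy]; exact: lip.
have missK u w : K u -> K w -> ~ cone v al be (u - w).
  by move=> [Su uy] [Sw /= wy]; apply: miss => //; exact: le_trans wy rs.
pose p u := dotr u v; pose g u := dotr u (perp v).
pose A0 := 4 * `|v| / dotr v v.
have A00 : 0 < A0 by rewrite divr_gt0// mulr_gt0// normr_gt0.
have pK u w : K u -> K w -> (A0 * (1 + L))^-1 * `|u - w| <= `|p u - p w|.
  move=> Ku Kw; rewrite -dotrBl mulrC ler_pdivrMr; last by apply: mulr_gt0; rewrite ?addr_gt0.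
  have h := lipK _ _ Ku Kw; have h0 := normr_ge0 (dotr (u - w) v).
  have [h1|h1] := frame_norm (u - w) v0; apply: (le_trans h1); rewrite -/A0 mulrCA ler_pM2l//.
    have := mulr_ge0 (ltW L0) h0; lra.
  lra.
pose A := p @` K.
have cA : compact A.
  apply: continuous_compact; first by apply: continuous_subspaceT; exact: continuous_dotr.
  apply: compact_closedI => //.
  rewrite (_ : [set _ | _] = closed_ball_ Num.norm y r); first exact: closed_closed_ball_.
  by apply/seteqP; split => z /=; rewrite /closed_ball_/= distrC.
have nA : ~ mu.-negligible A.
  apply: (image_not_negligible cS regS _ _ Sy r0 rR pK).
    exact: continuous_dotr.
  by rewrite invr_gt0; apply: mulr_gt0; rewrite ?addr_gt0.
have Hphi a : exists u, A a -> K u /\ p u = a.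
  have [[u Ku <-]|] := pselect (A a); first by exists u.
  by exists 0.
have [phi phiP] := choice Hphi.
pose h a := g (phi a).
have pB a b : A a -> A b -> dotr (phi a - phi b) v = a - b.
  by move=> /phiP[_ pa] /phiP[_ pb]; rewrite dotrBl -/(p _) -/(p _) pa pb.
have gB a b : dotr (phi a - phi b) (perp v) = h a - h b by rewrite dotrBl.
have hL a b : A a -> A b -> `|h a - h b| <= L * `|a - b|.
  move=> Aa Ab; rewrite -gB -pB//; apply: lipK; [by have [] := phiP a Aa|by have [] := phiP b Ab].
have avoid a b : A a -> A b -> a < b ->
    h b - h a <= al * (b - a) \/ be * (b - a) <= h b - h a.
  move=> Aa Ab ab; have := missK _ _ (phiP b Ab).1 (phiP a Aa).1.
  rewrite /cone/= pB// gB expr2 => nc.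
  have ba : 0 < b - a by rewrite subr_gt0.
  have [h1|h1] := leP (h b - h a) (al * (b - a)); [by left|right].
  rewrite leNgt; apply/negP => h2; apply: nc.
  by rewrite ![_ * ((b - a) * _)]mulrCA !ltr_pM2l.
have closA : closed A by apply: compact_closed => //; exact: Rhausdorff.
have [A' [A'A nA' side]] := one_sided_piece closA hL (ltW L0) albe avoid nA.
have [a [b [A'a A'b ab]]] : exists a b, [/\ A' a, A' b & a < b].
  apply: contrapT => no; apply: nA'.
  have [[a A'a]|e] := pselect (A' !=set0).
    exists [set a]; split => //; first by rewrite lebesgue_measure_set1.
    move=> b A'b; have [ba|ab|//] := ltgtP b a; exfalso; apply: no.
      by exists b, a.
    by exists a, b.
  rewrite (_ : A' = set0); first exact: negligible_set0.
  by apply/seteqP; split => // z Az; apply: e; exists z.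
pose e := phi b - phi a.
have Aa := A'A _ A'a; have Ab := A'A _ A'b.
have d0 : 0 < b - a by rewrite subr_gt0.
exists (phi a), (phi b), A', phi, ((b - a) / (2 * dotr v v)); split => //.
- by have [[]] := phiP a Aa.
- by have [[]] := phiP b Ab.
- by rewrite divr_gt0// mulr_gt0.
split; first by move=> x /A'A /phiP[[]].
suff key x z : A' x -> A' z -> x < z ->
    (b - a) / (2 * dotr v v) * (z - x) <= dotr (phi z - phi x) e.
  move=> x z A'x A'z; rewrite -dotrBl.
  have [xz|zx|->] := ltgtP x z.
  - rewrite distrC gtr0_norm ?subr_gt0//.
    rewrite (_ : dotr (phi x - phi z) _ = - dotr (phi z - phi x) e); last first.
      by rewrite /e !dotr2E !mxE; ring.
    by rewrite normrN (le_trans (key _ _ A'x A'z xz))// ler_norm.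
  - by rewrite gtr0_norm ?subr_gt0// (le_trans (key _ _ A'z A'x zx))// ler_norm.
  - by rewrite subrr normr0 mulr0.
move=> A'x A'z xz.
have Ax := A'A _ A'x; have Az := A'A _ A'z.
have X0 : 0 < z - x by rewrite subr_gt0.
have nd : 0 < 2 * dotr v v by rewrite mulr_gt0.
rewrite mulrAC ler_pdivrMr//.
have := frame_decomp v (phi z - phi x) e; rewrite /e !pB// !gB => fd.
have HL1 : `|h z - h x| <= L * (z - x) by have := hL _ _ Az Ax; rewrite (gtr0_norm X0).
have HL2 : `|h b - h a| <= L * (b - a) by have := hL _ _ Ab Aa; rewrite (gtr0_norm d0).
have scale (t X : R) : t <= (2 * L)^-1 * X -> 2 * L * t <= X.
  by move=> ht; rewrite mulrC -ler_pdivlMr ?mulr_gt0// mulrC.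
have prod : - ((z - x) * (b - a) / 2) <= (h z - h x) * (h b - h a).
  case: side => side.
    apply: (@prod_lower_bound _ _ _ L) => //; apply: scale.
      apply: (le_trans (side _ _ A'x A'z xz)); rewrite ler_pM2r//.
      exact: le_trans (ltW albe) be1.
    apply: (le_trans (side _ _ A'a A'b ab)); rewrite ler_pM2r//.
    exact: le_trans (ltW albe) be1.
  rewrite -[leRHS]mulrNN; apply: (@prod_lower_bound _ _ _ L); rewrite ?normrN//; apply: scale.
    rewrite lerNl -mulNr; apply: le_trans (side _ _ A'x A'z xz); rewrite ler_pM2r//.
    exact: le_trans al1 (ltW albe).
  rewrite lerNl -mulNr; apply: le_trans (side _ _ A'a A'b ab); rewrite ler_pM2r//.
  exact: le_trans al1 (ltW albe).
move: fd; rewrite -/e; set E := dotr _ e.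
move=> fd; lra.
Qed.

Lemma chords_not_thin : S !=set0 -> exists x0, S x0 /\
  forall (t : R) (F : nat -> set R), t < 1 -> (forall i, box_thin t (F i)) ->
  ~ ([set dotr x1 (x2 - x0) | x1 in S & x2 in S] `<=` \bigcup_i F i).
Proof.
move=> S0; have [x0 [x2 [A' [phi [c [Sx0 Sx2 c0 nA' [Sphi expand]]]]]]] := expanding_chord S0.
exists x0; split => // t F t1 thinF cov; apply: nA'.
pose G x := dotr (phi x) (x2 - x0).
apply: (@negligibleS _ _ _ mu (\bigcup_i (A' `&` [set x | F i (G x)]))).
  move=> x A'x; have [|i _ Fi] := cov (G x).
    by exists (phi x); [exact: Sphi|exists x2].
  by exists i.
apply: negligible_bigcup => i.
apply: (thin_preimage_negligible c0 t1 (thinF i) (G := G)).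
  by move=> x y [Ax _] [Ay _]; exact: expand.
by move=> x [].
Qed.

End ChordCluster.

(** * Hausdorff measure as a metric outer measure *)

Section OuterMeasure.
Variables (R : realType) (d : nat) (s : R).
Implicit Types (A B : set 'rV[R]_d) (delta : R).
Local Open Scope ereal_scope.

Lemma diam_pow_ge0 A : 0 <= diam_pow s A.
Proof. by rewrite /diam_pow; case: ifP => // _; exact: poweR_ge0. Qed.

Lemma diam_pow0 : diam_pow s (set0 : set 'rV[R]_d) = 0.
Proof. by rewrite /diam_pow eqxx. Qed.

Lemma ediam_le A (c : R) : (0 <= c)%R ->
  (forall x y, A x -> A y -> (enorm (x - y) <= c)%R) -> ediam A <= c%:E.
Proof.
move=> c0 Ac; rewrite /ediam ge_max lee_fin c0/=; apply: ge_ereal_sup => _ [x Ax [y Ay <-]].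
by rewrite lee_fin Ac.
Qed.

Lemma ediam_ge A x y : A x -> A y -> (enorm (x - y))%:E <= ediam A.
Proof.
move=> Ax Ay; rewrite /ediam le_max; apply/orP; right.
by apply: ereal_sup_ubound; exists x => //; exists y.
Qed.

Lemma series_le (f : nat -> \bar R) (c : \bar R) : (forall i, 0 <= f i) ->
  (forall n, \sum_(0 <= i < n) f i <= c) -> \sum_(0 <= i <oo) f i <= c.
Proof.
move=> f0 fc; apply: lime_le; first by apply: is_cvg_nneseries => *; exact: f0.
by apply: nearW => n; exact: fc.
Qed.

Lemma content_ge0 delta A : 0 <= hausdorff_content s delta A.
Proof.
by apply: le_ereal_inf_tmp => _ [F _ <-]; apply: nneseries_ge0 => *; exact: diam_pow_ge0.
Qed.

Lemma content_le delta A B : A `<=` B ->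
  hausdorff_content s delta A <= hausdorff_content s delta B.
Proof.
move=> AB; apply: ereal_inf_le_tmp => _ [F [BF Fd] <-]; exists F => //.
by split => //; exact: subset_trans BF.
Qed.

Lemma content_anti delta delta' A : (delta <= delta')%R ->
  hausdorff_content s delta' A <= hausdorff_content s delta A.
Proof.
move=> dd; apply: ereal_inf_le_tmp => _ [F [BF Fd] <-]; exists F => //.
by split => // i; apply: le_trans (Fd i) _; rewrite lee_fin.
Qed.

Lemma content_le_diam delta A (c : R) : (0 <= s)%R -> (0 <= c <= delta)%R -> ediam A <= c%:E ->
  hausdorff_content s delta A <= (c `^ s)%:E.
Proof.
move=> s0 /andP[c0 cd] Ac.
have d0 : (0 <= delta)%R by exact: le_trans cd.
apply: (@le_trans _ _ (\sum_(0 <= i <oo) diam_pow s (if i == 0%N then A else set0))).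
  apply: ereal_inf_lbound; exists (fun i => if i == 0%N then A else set0) => //; split.
    by move=> x Ax; exists 0%N.
  move=> i; case: ifP => _; first by apply: (le_trans Ac); rewrite lee_fin.
  by apply: ediam_le.
apply: series_le => [i|n]; first exact: diam_pow_ge0.
have wA : diam_pow s A <= (c `^ s)%:E.
  rewrite /diam_pow; case: ifP => _; first by rewrite lee_fin powR_ge0.
  rewrite -poweR_EFin; apply: gt0_ler_poweR => //.
  by rewrite in_itv/= leey andbT /ediam le_max lexx.
  by rewrite in_itv/= leey andbT lee_fin.
case: n => [|n]; first by rewrite big_geq// lee_fin powR_ge0.
rewrite big_nat_recl//= big1 ?adde0// => i _; exact: diam_pow0.
Qed.

(** Interleave a cover of A and a cover of B. *)
Lemma content_setU delta A B :
  hausdorff_content s delta (A `|` B) <=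
  hausdorff_content s delta A + hausdorff_content s delta B.
Proof.
set a := hausdorff_content s delta A; set b := hausdorff_content s delta B.
have a0 : 0 <= a by exact: content_ge0.
have b0 : 0 <= b by exact: content_ge0.
have [->|aoo] := eqVneq a +oo; first by rewrite addye ?leey// -ltNye (lt_le_trans _ b0).
have [->|boo] := eqVneq b +oo; first by rewrite addey ?leey// -ltNye (lt_le_trans _ a0).
have afin : a \is a fin_num by rewrite ge0_fin_numE// ltey.
have bfin : b \is a fin_num by rewrite ge0_fin_numE// ltey.
apply/lee_addgt0Pr => e e0.
have e20 : (0 < e / 2)%R by rewrite divr_gt0.
have [_ [F [AF Fd] <-] Fa] := lb_ereal_inf_adherent e20 afin.
have [_ [G [BG Gd] <-] Gb] := lb_ereal_inf_adherent e20 bfin.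
(* the cover of A at even indices, that of B at odd ones *)
pose E n := if odd n then G n./2 else F n./2.
apply: (@le_trans _ _ (\sum_(0 <= i <oo) diam_pow s (E i))).
  apply: ereal_inf_lbound; exists E => //; split.
    move=> x [/AF[i _ Fi]|/BG[i _ Gi]].
      by exists i.*2 => //; rewrite /E odd_double doubleK.
    by exists i.*2.+1 => //; rewrite /E/= odd_double/= uphalf_double.
  by move=> i; rewrite /E; case: ifP.
have even n : \sum_(0 <= i < n.*2) diam_pow s (E i) =
    \sum_(0 <= i < n) diam_pow s (F i) + \sum_(0 <= i < n) diam_pow s (G i).
  elim: n => [|n IH]; first by rewrite !big_geq// adde0.
  rewrite doubleS !big_nat_recr//= IH /E/= odd_double/= uphalf_double doubleK.
  by rewrite -addeA addeACA.
have part (H : nat -> set 'rV[R]_d) n :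
    \sum_(0 <= i < n) diam_pow s (H i) <= \sum_(0 <= i <oo) diam_pow s (H i).
  by apply: nneseries_lim_ge => *; exact: diam_pow_ge0.
apply: (@le_trans _ _ ((a + (e / 2)%:E) + (b + (e / 2)%:E))).
  apply: series_le => [i|n]; first exact: diam_pow_ge0.
  apply: (@le_trans _ _ (\sum_(0 <= i < n.*2) diam_pow s (E i))).
    apply: lee_sum_nneg_natr => // [*|]; first exact: diam_pow_ge0.
    by rewrite -addnn leq_addr.
  rewrite even; apply: leeD; apply: (le_trans (part _ _)); exact: ltW.
by rewrite addeACA -EFinD -splitr.
Qed.

Local Notation H := (@hausdorff_measure R d s).

Lemma content_le_measure delta A : (0 < delta)%R -> hausdorff_content s delta A <= H A.
Proof. by move=> d0; apply: ereal_sup_ubound; exists delta. Qed.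

Lemma hausdorff_ge0 A : 0 <= H A.
Proof. by apply: le_trans (content_le_measure A ltr01); exact: content_ge0. Qed.

Lemma hausdorff_le A B : A `<=` B -> H A <= H B.
Proof.
move=> AB; apply: ge_ereal_sup => _ [delta /= d0 <-].
exact: le_trans (content_le delta AB) (content_le_measure _ d0).
Qed.

Lemma hausdorff_setU A B : H (A `|` B) <= H A + H B.
Proof.
apply: ge_ereal_sup => _ [delta /= d0 <-].
by apply: (le_trans (content_setU _ _ _)); apply: leeD; exact: content_le_measure.
Qed.

Lemma hausdorff0 : (0 <= s)%R -> H set0 = 0.
Proof.
move=> s0; apply/eqP; rewrite eq_le hausdorff_ge0 andbT.
apply: ge_ereal_sup => _ [delta /= d0 <-].
apply: (@le_trans _ _ (\sum_(0 <= i <oo) diam_pow s (set0 : set 'rV[R]_d))).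
  apply: ereal_inf_lbound; exists (fun=> set0) => //; split => // i.
  by apply: ediam_le => //; exact: ltW.
by rewrite diam_pow0 eseries0.
Qed.

Lemma sup_add_le (X Y : set (\bar R)) (z : \bar R) : X !=set0 -> Y !=set0 ->
  (forall x, X x -> 0 <= x) -> (forall y, Y y -> 0 <= y) ->
  (forall x y, X x -> Y y -> x + y <= z) -> ereal_sup X + ereal_sup Y <= z.
Proof.
move=> [x0 Xx0] [y0 Yy0] X0 Y0 XYz.
have [->|zoo] := eqVneq z +oo; first by rewrite leey.
have z0 : 0 <= z by apply: le_trans (XYz _ _ Xx0 Yy0); apply: adde_ge0; [exact: X0|exact: Y0].
have zfin : z \is a fin_num by rewrite ge0_fin_numE// ltey.
have Yfin y : Y y -> y \is a fin_num.
  move=> Yy; rewrite ge0_fin_numE ?Y0//; apply: (@le_lt_trans _ _ z); last by rewrite ltey.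
  by apply: le_trans (XYz _ _ Xx0 Yy); rewrite leeDr//; exact: X0.
have supX0 : 0 <= ereal_sup X by apply: le_trans (X0 _ Xx0) _; exact: ereal_sup_ubound.
have supXy y : Y y -> ereal_sup X <= z - y.
  move=> Yy; apply: ge_ereal_sup => x Xx; rewrite leeBrDr ?Yfin//; exact: XYz.
have supXfin : ereal_sup X \is a fin_num.
  rewrite ge0_fin_numE//; apply: (le_lt_trans (supXy _ Yy0)).
  by rewrite ltey_eq fin_numB zfin Yfin.
rewrite addeC -leeBrDr//; apply: ge_ereal_sup => y Yy.
by rewrite leeBrDr// addeC -leeBrDr ?Yfin//; exact: supXy.
Qed.

(** A set of diameter less than c cannot meet both A and B, so that a fine cover
of the union splits into a cover of A and a cover of B. *)
Lemma hausdorff_separated A B (c : R) : (0 < c)%R ->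
  (forall x y, A x -> B y -> (c <= enorm (x - y))%R) ->
  H A + H B <= H (A `|` B).
Proof.
move=> c0 AB; apply: sup_add_le.
- by exists (hausdorff_content s 1 A); exists 1%R => //=.
- by exists (hausdorff_content s 1 B); exists 1%R => //=.
- by move=> _ [delta _ <-]; exact: content_ge0.
- by move=> _ [delta _ <-]; exact: content_ge0.
move=> _ _ [d1 /= d10 <-] [d2 /= d20 <-].
pose delta := Num.min (Num.min d1 d2) (c / 2)%R.
have dl0 : (0 < delta)%R by rewrite !lt_min d10 d20 divr_gt0.
have [dl1 dl2 dlc] : [/\ (delta <= d1)%R, (delta <= d2)%R & (delta <= c / 2)%R].
  by rewrite !ge_min !lexx !orbT.
apply: (@le_trans _ _ (hausdorff_content s delta (A `|` B))); last exact: content_le_measure.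
apply: le_ereal_inf_tmp => _ [F [ABF Fd] <-].
pose FA i := if pselect (F i `&` A !=set0) then F i else set0.
pose FB i := if pselect (F i `&` A !=set0) then set0 else F i.
have -> : \sum_(0 <= i <oo) diam_pow s (F i) =
    \sum_(0 <= i <oo) (diam_pow s (FA i) + diam_pow s (FB i)).
  apply: eq_eseriesr => i _; rewrite /FA /FB; case: pselect => ?;
  by rewrite diam_pow0 ?adde0 ?add0e.
rewrite nneseriesD; last 2 first.
- by move=> i _ _; exact: diam_pow_ge0.
- by move=> i _ _; exact: diam_pow_ge0.
have e0 : ediam (set0 : set 'rV[R]_d) <= delta%:E by apply: ediam_le => //; exact: ltW.
apply: leeD.
  apply: le_trans (content_anti A dl1) _; apply: ereal_inf_lbound; exists FA => //; split.
    move=> x Ax; have [|i _ Fi] := ABF x; first by left.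
    by exists i => //; rewrite /FA; case: pselect => // n; exfalso; apply: n; exists x.
  by move=> i; rewrite /FA; case: pselect => ?; [exact: Fd|exact: e0].
apply: le_trans (content_anti B dl2) _; apply: ereal_inf_lbound; exists FB => //; split.
  move=> y By; have [|i _ Fi] := ABF y; first by right.
  exists i => //; rewrite /FB; case: pselect => // -[x [Fix Ax]]; exfalso.
  have := AB _ _ Ax By; apply/negP; rewrite -ltNge.
  have := le_trans (ediam_ge Fix Fi) (Fd i); rewrite lee_fin.
  by move=> h; apply: (le_lt_trans h); apply: (le_lt_trans dlc); lra.
by move=> i; rewrite /FB; case: pselect => ?; [exact: e0|exact: Fd].
Qed.

End OuterMeasure.

(** * From Ahlfors-David regularity to counting *)

Section EuclideanNorm.
Variable R : realType.
Implicit Types x y : 'rV[R]_2.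

Lemma norm_le_enorm x : `|x| <= enorm x.
Proof.
have h i : `|x ord0 i| <= enorm x.
  rewrite -sqrtr_sqr /enorm ler_wsqrtr// dotr2E -!expr2.
  have [->|->] : i = 0 \/ i = 1.
    by case: i => [[|[|//]]] ?; [left|right]; apply: val_inj.
    by rewrite lerDl sqr_ge0.
  by rewrite lerDr sqr_ge0.
by apply: norm_le_coord.
Qed.

Lemma enorm_le x : enorm x <= 2 * `|x|.
Proof.
have n0 := normr_ge0 x.
rewrite /enorm -[leRHS]ger0_norm ?mulr_ge0// -sqrtr_sqr ler_wsqrtr//.
have h i : x ord0 i * x ord0 i <= `|x| * `|x|.
  rewrite -[leLHS]ger0_norm ?normrM; last by rewrite -expr2 sqr_ge0.
  by apply: ler_pM => //; exact: coord_le_norm.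
rewrite dotr2E expr2; have := h 0; have := h 1; have := mulr_ge0 n0 n0; lra.
Qed.

End EuclideanNorm.

Section Support.
Variables (R : realType) (s C : R) (K : set 'rV[R]_2).
Hypothesis s1 : 1 <= s.
Hypothesis cK : compact K.
Hypothesis ADK : AD_regular_with s C K.
Local Notation H := (@hausdorff_measure R 2 s).
Local Notation nu := (fun A => H (A `&` K)).
Local Notation S := (spt nu).

Let s0 : 0 <= s. Proof. exact: le_trans s1. Qed.

Lemma hausdorff_cover (I : eqType) (l : seq I) (f : I -> set 'rV[R]_2) T :
  (forall x, T x -> exists2 i, i \in l & f i x) ->
  (H T <= \sum_(i <- l) H (f i))%E.
Proof.
elim: l T => [|i l IH] T Tl.
  rewrite big_nil (_ : T = set0) ?hausdorff0//.
  by apply/seteqP; split => // x /Tl[].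
rewrite big_cons; apply: (@le_trans _ _ (H (f i `|` (T `\` f i)))).
  apply: hausdorff_le => x Tx.
  by have [fx|nfx] := pselect (f i x); [left|right].
apply: (le_trans (hausdorff_setU _ _ _)); apply: leeD => //.
apply: IH => x [Tx nfx]; have [j] := Tl x Tx.
by rewrite inE => /orP[/eqP->//|jl fj]; exists j.
Qed.

Lemma sum_balls_le (d : R) (l : seq 'rV[R]_2) : 0 < d -> separated d l ->
  (\sum_(y <- l) nu (eball y (d / 4)) <=
   H [set z | K z /\ exists2 y, y \in l & eball y (d / 4) z])%E.
Proof.
move=> d0; elim: l => [|y l IH] /=; first by rewrite big_nil hausdorff_ge0.
move=> /andP[/allP yl /IH{}IH]; rewrite big_cons.
apply: (le_trans (leeD (lexx _) IH)).
have d20 : 0 < d / 2 by rewrite divr_gt0.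
apply: (@le_trans _ _ _ _ _ (hausdorff_separated s d20 _)) => [a b [ya Ka] [Kb [z zl zb]]|].
  apply: le_trans (norm_le_enorm _).
  have h1 := le_trans (norm_le_enorm _) ya; have h2 := le_trans (norm_le_enorm _) zb.
  have h3 := yl z zl.
  have : `|y - z| <= `|y - a| + `|a - b| + `|z - b|.
    rewrite (_ : y - z = (y - a) + (a - b) - (z - b)); last first.
      by rewrite opprB !subrKA.
    by apply: (le_trans (ler_normB _ _)); rewrite lerD2r ler_normD.
  lra.
apply: hausdorff_le => z [[yz Kz]|[Kz [w wl wz]]].
  by split => //; exists y; rewrite ?mem_head.
by split => //; exists w; rewrite ?inE ?wl ?orbT.
Qed.

Lemma closedK : closed K.
Proof. by apply: compact_closed => //; exact: norm_hausdorff. Qed.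

(** A compact set that misses the support is covered by finitely many open sets of
measure 0. *)
Lemma compact_off_support T : compact T -> T `<=` K -> T `&` S = set0 -> H T = 0%E.
Proof.
move=> cT TK TS; apply/eqP; rewrite eq_le hausdorff_ge0 andbT.
pose D := [set U : set 'rV[R]_2 | open U /\ (nu U <= 0)%E].
move: cT; rewrite compact_cover => /(_ (set 'rV[R]_2) D id) [|x Tx|D' D'D TD'].
- by move=> U [].
- have /existsNP[U /not_implyP[[oU Ux] nU]] : ~ S x.
    by move=> Sx; have : (T `&` S) x by []; rewrite TS.
  exists U => //; split => //.
  by rewrite leNgt; apply/negP.
have HT : (H T <= \sum_(U <- finmap.enum_fset D') nu U)%E.
  apply: hausdorff_cover => x Tx; have [U /= UD' Ux] := TD' x Tx.
  by exists U => //; split => //; exact: TK.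
apply: (le_trans HT).
rewrite big_seq; apply: sume_le0 => U /D'D; rewrite inE => -[_ //].
Qed.

Lemma support_sub : S `<=` K.
Proof.
move=> x Sx; apply: contrapT => nKx.
have := Sx (~` K); rewrite setICl hausdorff0// ltxx => /(_ _)/notF; apply.
by split => //; exact: closed_openC closedK.
Qed.

Lemma closed_support : closed S.
Proof.
move=> x clx U [oU Ux].
have [y [Sy Uy]] := clx U (open_nbhs_nbhs (conj oU Ux)).
exact: Sy.
Qed.

Lemma compact_support : compact S.
Proof.
rewrite (_ : S = K `&` S); first exact: compact_closedI cK closed_support.
by apply/esym/setIidr; exact: support_sub.
Qed.

Lemma support_neq0 : S !=set0.
Proof.
apply/set0P/eqP => S0; have [_ /andP[HK _] _] := ADK.
by move: HK; rewrite (compact_off_support cK) ?ltxx// S0 setI0.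
Qed.

(** If the support were a point p then, for each delta, all of K but a set of
diameter at most delta around p would be null by [compact_off_support], so that
the delta-content of K would be at most delta^s.  As the content increases when delta
decreases, the measure of K would vanish.  Without this lemma the regularity
condition could be void. *)
Lemma support_not_singleton : exists2 R0 : R, 0 < R0 & (R0%:E <= ediam S)%E.
Proof.
have [p Sp] := support_neq0.
have [[q [Sq pq]]|no] := pselect (exists q, S q /\ p != q).
  exists (enorm (p - q)); last exact: ediam_ge.
  by apply: lt_le_trans (norm_le_enorm _); rewrite normr_gt0 subr_eq0.
have Sp1 q : S q -> q = p.
  by move=> Sq; apply/eqP; rewrite eq_sym; apply: contrapT => /negP pq; apply: no; exists q.
have [_ /andP[HK _] _] := ADK; exfalso; move: HK; apply/negP; rewrite -leNgt.
have small (delta : R) : 0 < delta -> (hausdorff_content s delta K <= (delta `^ s)%:E)%E.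
  move=> d0; pose Q := K `&` [set z | `|z - p| < delta / 4].
  pose T := K `\` [set z | `|z - p| < delta / 4].
  have HT : H T = 0%E.
    apply: compact_off_support.
    - apply: compact_closedI => //; apply: open_closedC.
      rewrite (_ : [set _ | _] = ball p (delta / 4)); first exact: ball_open.
      by apply/seteqP; split => z /=; rewrite -ball_normE/= distrC.
    - by move=> z [].
    - apply/seteqP; split => // z [[_ /= pz] /Sp1 zp]; apply: pz.
      by rewrite zp subrr normr0 divr_gt0.
  rewrite (_ : K = Q `|` T); last first.
    apply/seteqP; split => [z Kz|z [[]|[]]//].
    by have [?|?] := pselect (`|z - p| < delta / 4); [left|right].
  apply: (le_trans (content_setU _ _ _ _)).
  have := content_le_measure s T d0; rewrite HT => cT.
  rewrite -[leRHS]adde0; apply: leeD => //.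
  apply: content_le_diam => //; first by rewrite lexx ltW.
  apply: ediam_le; first exact: ltW.
  move=> x y [_ /= xp] [_ /= yp]; apply: (le_trans (enorm_le _)).
  rewrite -(subrKA p); have := ler_normD (x - p) (p - y); rewrite [`|p - y|]distrC; lra.
apply: ge_ereal_sup => _ [delta /= d0 <-].
apply/lee_addgt0Pr => e e0; rewrite add0e.
pose d' := Num.min delta (Num.min 1 e).
have d'0 : 0 < d' by rewrite !lt_min d0 ltr01.
have [h1 h2 h3] : [/\ d' <= delta, d' <= 1 & d' <= e] by rewrite !ge_min !lexx !orbT.
apply: (le_trans (content_anti s K h1)); apply: (le_trans (small _ d'0)).
rewrite lee_fin; apply: le_trans h3.
rewrite -[leRHS]powRr1 ?(ltW d'0)//.
by apply: ger_powR => //; rewrite d'0 h2.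
Qed.

End Support.

Lemma sum_seq_const (R : realType) (I : Type) (l : seq I) (t : R) :
  \sum_(i <- l) t = (size l)%:R * t.
Proof.
elim: l => [|i l IH]; first by rewrite big_nil mul0r.
by rewrite big_cons IH /= -natr1 mulrDl mul1r addrC.
Qed.

Lemma powR_exp2 (R : realType) (s : R) k : (2 ^+ k) `^ s = (2 `^ s) ^+ k.
Proof.
elim: k => [|k IH]; first by rewrite !expr0 powR1.
by rewrite !exprS powRM ?exprn_ge0// IH.
Qed.

(** Upper bound: the balls of radius d / 4 around d-separated points are at positive
mutual distance, hence their measures add up.  Lower bound: the balls of radius 2 d around
a maximal d-separated list cover the ball up to a compact set that misses the
support. *)
Lemma support_counting_regular (R : realType) (s C : R) (K : set 'rV[R]_2) :
  1 <= s -> compact K -> AD_regular_with s C K ->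
  exists D C' R0, counting_regular
    (spt (fun A => hausdorff_measure s (A `&` K))) D C' R0.
Proof.
move=> s1 cK ADK; have s0 : 0 <= s by exact: le_trans s1.
have [_ _ [C1 AD]] := ADK.
set nu := (fun A => hausdorff_measure s (A `&` K)) in AD *.
set S := spt nu in AD *.
have [e0 e00 e0S] := support_not_singleton s1 cK ADK.
have C0 : 0 < C by lra.
have lowb x r : S x -> 0 < r -> r <= e0 -> ((r `^ s / C)%:E <= nu (eball x r))%E.
  move=> Sx r0 re; have hr : (r%:E <= ediam S)%E.
    by apply: le_trans e0S; rewrite lee_fin.
  by have /andP[] := AD x r Sx r0 hr.
have uppb x r : S x -> 0 < r -> r <= e0 -> (nu (eball x r) <= (C * r `^ s)%:E)%E.
  move=> Sx r0 re; have hr : (r%:E <= ediam S)%E.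
    by apply: le_trans e0S; rewrite lee_fin.
  by have /andP[] := AD x r Sx r0 hr.
pose D := 2 `^ s.
have D2 : 2 <= D.
  by rewrite /D -[leLHS]powRr1//; apply: ler_powR => //; rewrite ler1n.
have s16 : 1 <= 16 `^ s by rewrite -[leLHS](powRr0 (16 : R)); apply: ler_powR => //; rewrite ler1n.
have D16 : D <= 16 `^ s by apply: ge0_ler_powR; rewrite ?nnegrE//; lra.
pose C' := C ^+ 2 * 16 `^ s.
have C21 : 1 <= C ^+ 2 by exact: exprn_ege1.
have C'1 : 1 <= C' by exact: mulr_ege1.
exists D, C', (e0 / 4); split => //; first by rewrite divr_gt0.
move=> x r k Sx r0 re.
set d := r / 2 ^+ k.
have p2 : 0 < 2 ^+ k :> R by rewrite exprn_gt0.
have p21 : 1 <= 2 ^+ k :> R by rewrite exprn_ege1// ler1n.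
have d0 : 0 < d by rewrite divr_gt0.
have dr : d <= r by rewrite ler_pdivrMr// ler_peMr// ltW.
have upper (l : seq 'rV[R]_2) : (forall y, y \in l -> S y /\ `|y - x| <= r) ->
    separated d l -> (size l)%:R <= C' * D ^+ k.
  move=> lS lsep.
  have h1 : (((size l)%:R * ((d / 4) `^ s / C))%:E <= (C * (4 * r) `^ s)%:E)%E.
    apply: (@le_trans _ _ (\sum_(y <- l) nu (eball y (d / 4)))%E).
      rewrite -sum_seq_const -sumEFin big_seq [leRHS]big_seq; apply: lee_sum => y /lS[Sy _].
      by apply: lowb => //; lra.
    apply: (le_trans (sum_balls_le s K d0 lsep)).
    apply: le_trans (uppb x (4 * r) Sx _ _); [|lra|lra].
    apply: hausdorff_le => z [Kz [y yl yz]]; split => //; rewrite /eball/closed_ball_/=.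
    apply: (le_trans (enorm_le _)).
    have [_ yx] := lS y yl; have := le_trans (norm_le_enorm _) yz => h.
    have : `|x - z| <= `|y - x| + `|y - z|.
      by rewrite -(subrKA y) [X in _ <= X + _]distrC ler_normD.
    lra.
  rewrite lee_fin in h1.
  (* the outer radius 4 r in terms of the inner radius d / 4; whence 16 `^ s in C' *)
  have e4 : 4 * r = 16 * (2 ^+ k * (d / 4)).
    by rewrite /d; field; rewrite gt_eqF.
  have d40 : 0 < d / 4 by rewrite divr_gt0.
  have e5 : (4 * r) `^ s = 16 `^ s * (D ^+ k * (d / 4) `^ s).
    have q0 : 0 <= d / 4 by exact: ltW.
    have p0 : 0 <= 2 ^+ k :> R by exact: ltW.
    rewrite e4 (powRM s (ler0n _ 16) (mulr_ge0 p0 q0)) (powRM s p0 q0).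
    by rewrite powR_exp2.
  rewrite e5 in h1.
  have P0 : 0 < (d / 4) `^ s by rewrite powR_gt0.
  move: h1; rewrite mulrA ler_pdivrMr// => h1.
  by rewrite -(ler_pM2r P0) (le_trans h1)// /C' expr2 le_eqVlt; apply/orP; left; apply/eqP; ring.
split; first exact: upper.
pose valid (l : seq 'rV[R]_2) := (forall y, y \in l -> S y /\ `|y - x| <= r) /\ separated d l.
have [l [lS lsep] lmax] : exists2 l, valid l & forall l', valid l' -> (size l' <= size l)%N.
  pose P n := `[< exists2 l, valid l & size l = n >].
  have P0 : exists n, P n by exists 0%N; apply/asboolP; exists [::].
  have Pb n : P n -> (n <= Num.truncn (C' * D ^+ k))%N.
    move=> /asboolP[l [lS lsep] <-]; rewrite -ltnS -(ltr_nat R).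
    by apply: le_lt_trans (truncnS_gt _); exact: upper.
  have [m /asboolP[l vl <-] mmax] := ex_maxnP P0 Pb.
  by exists l => // l' vl'; apply: mmax; apply/asboolP; exists l'.
exists l; split => //.
have cover z : S z -> `|z - x| <= r -> exists2 y, y \in l & `|z - y| < d.
  move=> Sz zx; apply: contrapT => no.
  have : valid (z :: l).
    split; first by move=> y; rewrite inE => /orP[/eqP->//|/lS].
    rewrite /separated/=; apply/andP; split => //; apply/allP => y yl.
    by rewrite leNgt; apply/negP => zy; apply: no; exists y.
  by move=> /lmax/=; rewrite ltnn.
pose T := K `&` ([set z | `|z - x| <= r] `&` \bigcap_(y in [set` l]) [set z | d <= `|z - y|]).
pose Q := K `&` [set z | exists2 y, y \in l & `|z - y| < d].
have HT : hausdorff_measure s T = 0%E.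
  apply: (compact_off_support (K := K) s1).
  - apply: compact_closedI => //; apply: closedI.
      rewrite (_ : [set _ | _] = closed_ball_ Num.norm x r); first exact: closed_closed_ball_.
      by apply/seteqP; split => z /=; rewrite /closed_ball_/= distrC.
    apply: closed_bigI => y _.
    rewrite (_ : [set _ | _] = ~` ball y d); first by apply: open_closedC; exact: ball_open.
    apply/seteqP; split => z /=; rewrite -ball_normE/= distrC leNgt.
      by move/negP.
    by move/negP.
  - by move=> z [].
  - apply/seteqP; split => // z [[_ [zx zl]] Sz].
    have [y yl] := cover z Sz zx; apply/negP; rewrite -leNgt; exact: zl.
have h1 : ((r `^ s / C)%:E <= ((size l)%:R * (C * (2 * d) `^ s))%:E)%E.
  apply: (le_trans (lowb x r Sx r0 _)); first lra.
  apply: (@le_trans _ _ (hausdorff_measure s (T `|` Q))).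
    apply: hausdorff_le => z [xz Kz].
    have zx : `|z - x| <= r by rewrite distrC (le_trans (norm_le_enorm _)).
    have [[y yl zy]|no] := pselect (exists2 y, y \in l & `|z - y| < d); [right|left].
      by split => //; exists y.
    split => //; split => // y yl /=; rewrite leNgt; apply/negP => zy.
    by apply: no; exists y.
  apply: (le_trans (hausdorff_setU _ _ _)); rewrite HT add0e.
  apply: (@le_trans _ _ (\sum_(y <- l) nu (eball y (2 * d)))%E).
    apply: (hausdorff_cover s1) => z [Kz [y yl zy]]; exists y => //; split => //.
    rewrite /eball/closed_ball_/= (le_trans (enorm_le _))// distrC; lra.
  rewrite -sum_seq_const -sumEFin big_seq [leRHS]big_seq; apply: lee_sum => y /lS[Sy _].
  by apply: uppb => //; lra.
rewrite lee_fin in h1.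
have er : 2 * r = 2 ^+ k * (2 * d) by rewrite /d; field; rewrite gt_eqF.
have e2 : D * r `^ s = D ^+ k * (2 * d) `^ s.
  have q0 : 0 <= 2 * d by rewrite mulr_ge0// ltW.
  have p0 : 0 <= 2 ^+ k :> R by exact: ltW.
  have r0' : 0 <= r by exact: ltW.
  by rewrite -powRM// er powRM// powR_exp2.
have P0 : 0 < (2 * d) `^ s by rewrite powR_gt0// mulr_gt0.
rewrite -(ler_pM2r P0) -e2.
have D0 : 0 < D by lra.
move: h1; rewrite ler_pdivrMr// => h1.
apply: (le_trans (ler_wpM2l (ltW D0) h1)).
rewrite (_ : D * _ = D * (C ^+ 2 * (size l)%:R * (2 * d) `^ s)); last by rewrite expr2; ring.
rewrite (_ : C' * _ * _ = 16 `^ s * (C ^+ 2 * (size l)%:R * (2 * d) `^ s)); last first.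
  by rewrite /C'; ring.
by rewrite ler_wpM2r// !mulr_ge0// ?ltW// sqr_ge0.
Qed.

(** * Packing dimension of subsets of the line *)

Section PackingDimensionLine.
Variable R : realType.
Implicit Types (F : set R) (t : R).

Lemma covering_number_ge0 F (d : R) : (0 <= covering_number F d)%E.
Proof. by apply: le_ereal_inf_tmp => _ [n _ <-]; rewrite lee_fin. Qed.

Lemma box_dim_thin F t : 0 <= t -> (upper_box_dim F < t%:E)%E -> box_thin t F.
Proof.
move=> t0 /ereal_inf_lt[_ [W W0 <-] Wt].
have /nbhs_ballP[e /= e0 eW] : nbhs (0 : R) (fun d => 0 < d -> W d) := W0.
exists (Num.min e 1); first by rewrite lt_min e0 ltr01.
move=> d d0; rewrite lt_min => /andP[de d1].
have Wd : W d.
  by apply: eW => //; rewrite /ball/= sub0r normrN gtr0_norm.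
have L0 : 0 < - ln d by rewrite oppr_gt0 ln_lt0// d0.
have : (lne (covering_number F d) * ((- ln d)^-1)%:E < t%:E)%E.
  by apply: le_lt_trans Wt; apply: ereal_sup_ubound; exists d.
rewrite lte_pdivrMr// -EFinM => lneN.
have : (covering_number F d < (expR (t * - ln d))%:E)%E.
  have cN : covering_number F d \in `[0%E, +oo%E].
    by rewrite in_itv/= covering_number_ge0 leey.
  have cE : (expR (t * - ln d))%:E \in `[0%E, +oo%E].
    by rewrite in_itv/= lee_fin expR_ge0 leey.
  by rewrite -(lte_lne cN cE) lne_EFin ?expR_gt0// expRK.
move=> /ereal_inf_lt[_ [n [c Fc] <-]]; rewrite lte_fin => nlt.
exists n, c; split => //.
have [->|n0] := posnP n; first by rewrite ln0// mulr_ge0// ltW.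
by rewrite -[leRHS]expRK ler_ln ?posrE ?ltr0n ?expR_gt0//; exact: ltW.
Qed.

(** An interval is covered by at most (B + 1) / d balls of radius d <= 1. *)
Lemma upper_box_dim_itv (B : R) : 0 < B -> (upper_box_dim [set x : R | (`|x| <= B)%R] <= 1)%E.
Proof.
move=> B0; apply/lee_addgt0Pr => e e0.
pose L := Num.max 1 (ln (B + 1) / e).
have L1 : 1 <= L by rewrite le_max lexx.
have L2 : ln (B + 1) / e <= L by rewrite le_max lexx orbT.
have d10 : 0 < expR (- L) by exact: expR_gt0.
apply: (@le_trans _ _ (ereal_sup [set (lne (covering_number [set x : R | (`|x| <= B)%R] d) *
    ((- ln d)^-1)%:E)%E | d in [set d : R | (0 < d < expR (- L))%R]])).
  apply: ereal_inf_lbound; exists [set d : R | 0 < d < expR (- L)] => //.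
  suff : nbhs (0 : R) (fun d => 0 < d -> [set d : R | 0 < d < expR (- L)] d) by [].
  apply/nbhs_ballP; exists (expR (- L)) => //= d.
  by rewrite /ball/= sub0r normrN => dL d0; rewrite d0 (le_lt_trans (ler_norm d)).
apply: ge_ereal_sup => _ [d /= /andP[d0 dL] <-].
have lnd : ln d < - L by rewrite -[ltRHS]expRK ltr_ln ?posrE.
have d1 : d <= 1 by rewrite leNgt; apply/negP => /ln_gt0; lra.
have Ld0 : 0 < - ln d by lra.
pose n := (Num.truncn (B / d)).+1.
have nB : B / d < n%:R by exact: truncnS_gt.
have nB' : n%:R <= (B + 1) / d.
  have h1 : (Num.truncn (B / d))%:R <= B / d by rewrite truncn_le// divr_ge0// ltW.
  have h2 : 1 <= 1 / d by rewrite ler_pdivlMr// mul1r.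
  by rewrite /n -natr1 mulrDl; lra.
have cov : (covering_number [set x : R | (`|x| <= B)%R] d <= n%:R%:E)%E.
  apply: ereal_inf_lbound; exists n => //.
  exists (fun i : 'I_n => - B + d * (2 * (i : nat)%:R + 1)) => x /= xB.
  pose k := Num.truncn ((x + B) / (2 * d)).
  have d20 : 0 < 2 * d by rewrite mulr_gt0.
  move: xB; rewrite ler_norml => /andP[x1 x2].
  have y0 : 0 <= (x + B) / (2 * d) by apply: divr_ge0; [move: x1; lra|exact: ltW].
  have k1 : k%:R <= (x + B) / (2 * d) by rewrite truncn_le.
  have k2 : (x + B) / (2 * d) < k.+1%:R by exact: truncnS_gt.
  rewrite ler_pdivlMr// in k1; rewrite ltr_pdivrMr// -natr1 in k2.
  rewrite ltr_pdivrMr// in nB.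
  have [kn|nk] := ltnP k n.
    exists (Ordinal kn) => //; rewrite /closed_ball_/= ler_norml.
    by apply/andP; split; lra.
  have : n%:R <= k%:R :> R by rewrite ler_nat.
  move=> nkR; exfalso; have : n%:R * (2 * d) <= k%:R * (2 * d) by rewrite ler_pM2r.
  lra.
rewrite -EFinD lee_pdivrMr//.
have B1 : 0 < (B + 1) / d by rewrite divr_gt0//; lra.
apply: (@le_trans _ _ (lne ((B + 1) / d)%:E)).
  have cN : covering_number [set x : R | (`|x| <= B)%R] d \in `[0%E, +oo%E].
    by rewrite in_itv/= covering_number_ge0 leey.
  have cE : ((B + 1) / d)%:E \in `[0%E, +oo%E].
    by rewrite in_itv/= lee_fin ltW// leey.
  by rewrite (lee_lne cN cE); apply: (le_trans cov); rewrite lee_fin.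
rewrite lne_EFin// -EFinM lee_fin ln_div ?posrE//; last lra.
rewrite ler_pdivrMr// in L2.
have : L * e <= - ln d * e by rewrite ler_pM2r//; lra.
lra.
Qed.

Lemma packing_dim_le1 (T : set R) : bounded_set T -> (packing_dim T <= 1)%E.
Proof.
move=> [M [_ MT]]; have := MT (`|M| + 1).
have -> : M < `|M| + 1 by have := ler_norm M; lra.
move=> /(_ isT) {MT} MT.
have B0 : 0 < `|M| + 1 by rewrite ltr_wpDl.
move: (`|M| + 1) B0 MT => B B0 TB.
apply: (@le_trans _ _
  (ereal_sup (range (fun i : nat => upper_box_dim [set x : R | (`|x| <= B)%R])))).
  apply: ereal_inf_lbound; exists (fun=> [set x : R | (`|x| <= B)%R]) => //; split; last first.
    by move=> x /TB ?; exists 0%N.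
  move=> _; split.
    exists B; split; first exact: num_real.
    by move=> b Bb x /= xB; apply: (le_trans xB); exact: ltW.
  rewrite (_ : [set _ | _] = closed_ball_ Num.norm 0 B); first exact: closed_closed_ball_.
  by apply/seteqP; split => x /=; rewrite /closed_ball_/= sub0r normrN.
by apply: ge_ereal_sup => _ [i _ <-]; exact: upper_box_dim_itv.
Qed.

Lemma packing_dim_ge1 (T : set R) :
  (forall t (F : nat -> set R), t < 1 -> (forall i, closed (F i)) ->
     (forall i, box_thin t (F i)) -> ~ (T `<=` \bigcup_i F i)) ->
  (1 <= packing_dim T)%E.
Proof.
move=> H; rewrite leNgt; apply/negP => /ereal_inf_lt[_ [F [bcF TF] <-] sup1].
have [t [t0 t1 supt]] : exists t : R, [/\ 0 <= t, t < 1 &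
    (ereal_sup (range (fun i => upper_box_dim (F i))) < t%:E)%E].
  move: sup1; case: (ereal_sup _) => [r|//|_]; last by exists 0; split => //; exact: ltNyr.
  rewrite lte_fin => r1; exists (Num.max 0 ((r + 1) / 2)); split.
  - by rewrite le_max lexx.
  - by rewrite gt_max ltr01/=; lra.
  - by rewrite lte_fin lt_max; apply/orP; right; lra.
apply: (H t F t1) => // i; first by have [] := bcF i.
by apply: box_dim_thin => //; apply: le_lt_trans supt; apply: ereal_sup_ubound; exists i.
Qed.

End PackingDimensionLine.

(** * Dot products of regular sets *)

Lemma regular_dot_products (R : realType) (S : set 'rV[R]_2) (D C R0 : R) :
  compact S -> S !=set0 -> counting_regular S D C R0 ->
  exists x0, S x0 /\ forall t (F : nat -> set R), t < 1 ->
    (forall i, closed (F i)) -> (forall i, box_thin t (F i)) ->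
    ~ ([set dotr x1 (x2 - x0) | x1 in S & x2 in S] `<=` \bigcup_i F i).
Proof.
move=> cS S0 regS.
have [[x0 [v [al [be [Sx0 v0 albe dense]]]]]|nodense] := pselect (exists x0 v (al be : R),
    [/\ S x0, v != 0, al < be & forall al' be', al <= al' -> al' < be' -> be' <= be ->
      exists2 q, S q & cone v al' be' (q - x0)]).
  exists x0; split => // t F t1 cF thinF.
  exact: (dense_directions_not_thin cS regS Sx0 v0 albe t1 dense cF thinF).
have [x0 [Sx0 x0P]] : exists x0, S x0 /\
  forall (t : R) (F : nat -> set R), t < 1 -> (forall i, box_thin t (F i)) ->
  ~ ([set dotr x1 (x2 - x0) | x1 in S & x2 in S] `<=` \bigcup_i F i).
  apply: (chords_not_thin cS regS) => // x v al be Sx v0 albe.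
  apply: contrapT => no; apply: nodense; exists x, v, al, be; split => // al' be' h1 h2 h3.
  apply: contrapT => nq; apply: no; exists al', be'; split => // q Sq cq.
  by apply: nq; exists q.
by exists x0; split => // t F t1 _; exact: x0P.
Qed.

(** The point is found in the support; enlarging the support to K only enlarges the set
of dot products, and hence its packing dimension. *)
Theorem theorem1p4 (R : realType) (s : R) (K : set 'rV[R]_2) :
  1 <= s -> K !=set0 -> compact K -> AD_regular s K ->
  exists x0, K x0 /\
    packing_dim [set dotr x1 (x2 - x0) | x1 in K & x2 in K] = 1%E.
Proof.
move=> s1 _ cK [C ADK].
have [D [C' [R0 regS]]] := support_counting_regular s1 cK ADK.
have cS := compact_support s1 cK.
have S0 := support_neq0 s1 cK ADK.
have SK := @support_sub _ s K s1 cK.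
have [x0 [Sx0 x0P]] := regular_dot_products cS S0 regS.
exists x0; split; first exact: SK.
apply/eqP; rewrite eq_le; apply/andP; split.
  apply: packing_dim_le1.
  have [M [_ MK]] := compact_bounded cK.
  have KB x : K x -> `|x| <= `|M| + 1.
    by move=> Kx; apply: (MK (`|M| + 1)) => //; have := ler_norm M; lra.
  exists (2 * (2 * (`|M| + 1)) * (`|M| + 1)); split; first exact: num_real.
  move=> b Bb _ [x1 Kx1 [x2 Kx2 <-]] /=.
  apply: le_trans (ltW Bb); apply: (le_trans (dotr_le _ _)).
  have h : `|x2 - x0| <= 2 * (`|M| + 1).
    apply: (le_trans (ler_normB _ _)); have := KB _ Kx2; have := KB _ (SK _ Sx0); lra.
  by apply: ler_pM; rewrite ?mulr_ge0//; [rewrite ler_pM2l|exact: KB].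
apply: packing_dim_ge1 => t F t1 cF thinF cov.
apply: (x0P t F t1 cF thinF) => _ [x1 Sx1 [x2 Sx2 <-]].
by apply: cov; exists x1; [exact: SK|exists x2; [exact: SK|]].
Qed.
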